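(* Let $\Omega\subset\mathbb{R}^3$ be a Lipschitz domain, let $\Gamma\subsetneq\partial\Omega$, and suppose that $\partial\Omega=\Gamma\cup\Pi\cup(\partial\Omega\setminus\overline{\Gamma})$ is a piecewise $C^1$ dissection of $\partial\Omega$ (with $\Gamma_1=\Gamma$ and $\Gamma_2=\partial\Omega\setminus\overline{\Gamma}$). Then there exists a Lipschitz domain $\Omega^e\subset\mathbb{R}^3$ such that $$\Omega\cap\Omega^e=\emptyset\qquad\text{and}\qquad \partial\Omega\cap\partial\Omega^e=\Gamma\cup\Pi .$$ Furthermore, $\tilde\Omega=\Omega\cup\Gamma\cup\Omega^e$ is also a Lipschitz domain.
   Context: Lipschitz domain. Let $D$ be a nonempty, proper open subset of $\mathbb{R}^3$, $p\in\partial D$ and $\hat u$ a unit vector. $\partial D$ is a Lipschitz hypograph near $p$ in the $\hat u$-direction if there are orthogonal coordinates $(x_1,x_2,x_3)$ with $p=(0,0,0)$ and $\hat u=(0,0,1)$, numbers $r,h>0$, and a Lipschitz function $\zeta:[-r,r]^2\to\mathbb{R}$ with $\zeta(0,0)=0$ and $|\zeta|<h$ on $(-r,r)^2$, such that the open neighborhood (coordinate box near $p$ in the $\hat u$-direction) $\mathcal{C}_{r,h}=(-r,r)^2\times(-h,h)$ of $p$ satisfies: $\mathcal{C}_{r,h}\cap D=\{x\in\mathcal{C}_{r,h}:x_3<\zeta(x_1,x_2)\}$, $\mathcal{C}_{r,h}\cap\partial D=\{x\in\mathcal{C}_{r,h}:x_3=\zeta(x_1,x_2)\}$, $\mathcal{C}_{r,h}\cap\overline{D}^{c}=\{x\in\mathcal{C}_{r,h}:x_3>\zeta(x_1,x_2)\}$.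 $D$ is a Lipschitz domain if $\partial D$ is compact and, for every $p\in\partial D$, $\partial D$ is a Lipschitz hypograph near $p$ in some direction. (No connectedness or boundedness is required.) Piecewise $C^1$ dissection. Let $D$ be a Lipschitz domain. A disjoint union $\partial D=\Gamma_1\cup\Pi\cup\Gamma_2$, where $\Gamma_1,\Gamma_2$ are disjoint, nonempty, relatively open subsets of $\partial D$ having $\Pi$ as their common boundary in $\partial D$, is a piecewise $C^1$ dissection of $\partial D$ if for every $p\in\Pi$ there is a coordinate box $\mathcal{C}_{r,h}=(-r,r)^2\times(-h,h)$ near $p$ in orthogonal local coordinates $(x_1,x_2,x_3)$ with $p=(0,0,0)$, with a Lipschitz function $\zeta:[-r,r]^2\to\mathbb{R}$ satisfying $\zeta(0,0)=0$, $|\zeta|<h$ on $(-r,r)^2$, and such that within $\mathcal{C}_{r,h}$ the sets $D$, $\partial D$, $\overline{D}^{c}$ are given by $x_3<\zeta(x_1,x_2)$, $x_3=\zeta(x_1,x_2)$, $x_3>\zeta(x_1,x_2)$, respectively, and a Lipschitz function $\varrho:[-r,r]\to\mathbb{R}$, such that $\Gamma_1\cap\mathcal{C}_{r,h}=\{x\in\mathcal{C}_{r,h}:x_3=\zeta(x_1,x_2),\ x_2<\varrho(x_1)\}$, $\Pi\cap\mathcal{C}_{r,h}=\{x\in\mathcal{C}_{r,h}:x_3=\zeta(x_1,x_2),\ x_2=\varrho(x_1)\}$, $\Gamma_2\cap\mathcal{C}_{r,h}=\{x\in\mathcal{C}_{r,h}:x_3=\zeta(x_1,x_2),\ x_2>\varrho(x_1)\}$,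 and the map $x_1\mapsto(x_1,\varrho(x_1),\zeta(x_1,\varrho(x_1)))$ (where $(x_1,\varrho(x_1))\in(-r,r)^2$) is $C^1$ except at finitely many points. *)

(* Defs.v *)
(* R^3 is 'rV[R]_3; its norm in the library is the sup norm, equivalent to the
   Euclidean one: same open sets, same Lipschitz functions. *)
From HB Require Import structures.
From mathcomp Require Export all_boot all_order all_algebra.
From mathcomp Require Export all_classical all_reals all_analysis.

Set Implicit Arguments.
Unset Strict Implicit.
Unset Printing Implicit Defensive.

Export Order.TTheory GRing.Theory Num.Theory.
Export numFieldNormedType.Exports.

Local Open Scope classical_set_scope.
Local Open Scope ring_scope.

(* At the type [subspace S], and for A included in S, this is the boundary of
   A relative to S: the points outside S are isolated in [subspace S]. *)
Definition boundary (T : topologicalType) (A : set T) : set T :=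
  closure A `\` interior A.

Section LipschitzDomains.
Context {R : realType}.

Local Notation E3 := 'rV[R]_3.

(* The point of R^3 whose coordinates are x in the orthogonal frame with
   origin p and with axes the rows of the orthogonal matrix Q. *)
Definition frame_point (p : E3) (Q : 'M[R]_3) (x : E3) : E3 := p + x *m Q.

Definition coord_box (r h : R) : set E3 :=
  [set x | [/\ x 0 0 \in `]-r, r[, x 0 1 \in `]-r, r[ & x 0 2 \in `]-h, h[]].

(* The intersection of S with the coordinate box, in local coordinates. *)
Definition box_trace (p : E3) (Q : 'M[R]_3) (r h : R) (S : set E3) : set E3 :=
  coord_box r h `&` frame_point p Q @^-1` S.

(* zeta matters only on [-r, r]^2; it is a total function, whose values outside
   this square are irrelevant. *)
Definition hypograph_in_box (D : set E3) (p : E3) (Q : 'M[R]_3) (r h : R)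
    (zeta : R * R -> R) : Prop :=
  [/\ [/\ Q *m Q^T = 1%:M, 0 < r & 0 < h],
      [lipschitz zeta y | y in `[-r, r] `*` `[-r, r] ],
      zeta (0, 0) = 0,
      (forall y : R * R, (`]-r, r[ `*` `]-r, r[) y -> `|zeta y| < h) &
      [/\ box_trace p Q r h D =
            coord_box r h `&` [set x | x 0 2 < zeta (x 0 0, x 0 1)],
          box_trace p Q r h (boundary D) =
            coord_box r h `&` [set x | x 0 2 = zeta (x 0 0, x 0 1)] &
          box_trace p Q r h (~` closure D) =
            coord_box r h `&` [set x | x 0 2 > zeta (x 0 0, x 0 1)]]].

Definition unit_vector (u : E3) : Prop := \sum_i u 0 i ^+ 2 = 1.

Definition lipschitz_hypograph (D : set E3) (p u : E3) : Prop :=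
  exists (Q : 'M[R]_3) (r h : R) (zeta : R * R -> R),
    row 2 Q = u /\ hypograph_in_box D p Q r h zeta.

Definition lipschitz_domain (D : set E3) : Prop :=
  [/\ D !=set0, D <> setT, open D, compact (boundary D) &
      forall p, boundary D p ->
        exists u, unit_vector u /\ lipschitz_hypograph D p u].

Definition dissection_curve (rho : R -> R) (zeta : R * R -> R) (t : R) : E3 :=
  \row_(i < 3) [:: t; rho t; zeta (t, rho t)]`_i.

(* gamma is C^1 on the open set U except at finitely many points; as U minus a
   finite set is open, this involves no value of gamma outside U. *)
Definition C1_except_finite (U : set R) (gamma : R -> E3) : Prop :=
  exists F : set R, finite_set F /\
    forall t, (U `\` F) t ->
      derivable gamma t 1 /\ {for t, continuous (derive1 gamma)}.

Definition piecewise_C1_dissection (D G1 Pi G2 : set E3) : Prop :=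
  [/\ [/\ boundary D = G1 `|` Pi `|` G2,
          G1 `&` Pi = set0, G1 `&` G2 = set0 & Pi `&` G2 = set0],
      G1 !=set0 /\ G2 !=set0,
      open (G1 : set (subspace (boundary D))) /\
      open (G2 : set (subspace (boundary D))),
      boundary (G1 : set (subspace (boundary D))) = Pi /\
      boundary (G2 : set (subspace (boundary D))) = Pi &
      forall p, Pi p ->
        exists (Q : 'M[R]_3) (r h : R) (zeta : R * R -> R) (rho : R -> R),
          [/\ hypograph_in_box D p Q r h zeta,
              [lipschitz rho t | t in `[-r, r] ],
              [/\ box_trace p Q r h G1 = coord_box r h `&`
                    [set x | x 0 2 = zeta (x 0 0, x 0 1) /\ x 0 1 < rho (x 0 0)],
                  box_trace p Q r h Pi = coord_box r h `&`
                    [set x | x 0 2 = zeta (x 0 0, x 0 1) /\ x 0 1 = rho (x 0 0)] &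
                  box_trace p Q r h G2 = coord_box r h `&`
                    [set x | x 0 2 = zeta (x 0 0, x 0 1) /\ x 0 1 > rho (x 0 0)]] &
              C1_except_finite
                [set t | `|t| < r /\ `|rho t| < r]
                (dissection_curve rho zeta)]].

End LipschitzDomains.

(* Main.v *)
(* A set D is, near a boundary point p, a Lipschitz hypograph in some direction
   if and only if there is a vector u with x - s w in D for all x in D near p,
   all w near u and all small s > 0. The vectors u with this property form an
   open convex cone C(D, p), and Lipschitz domains can be handled through these
   cones alone: C behaves well under unions, intersections and complements, and
   the fattened set D_eps = D + B(0, eps) has at least the cones of D.

   Suppose that an open set W (a "wall" along Pi) contains Gamma, that its
   closure misses bd Omega \ cl Gamma, and that at every p in bd Omega the cone
   C(W, p) meets both C(Omega, p) and - C(Omega, p). Then, for small eps,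
   Omega^e = (W inter Omega_eps) \ cl Omega solves the problem.

   The wall is W = {G < 0} with G = sum_q phi_q g_q, where phi_q are tents
   supported in small balls covering bd Omega, g_q = -1 for q in Gamma, g_q = 1
   for q in bd Omega \ cl Gamma, and g_q = x_2 - rho(x_1), in the coordinates of
   the chart at q, for q in Pi. The signs of G on bd Omega are right by
   construction. At a point of Pi where the curve is not C^1 the balls are chosen
   so that only its own chart is active, and the wall is steep there. At any
   other p in Pi, let t be the tangent of the curve and y a limit of secants from
   p into Gamma. The differential of every active g_q kills t and the vertical
   v_q of its chart, is nonpositive at y, and v_q lies in C(Omega, p), which is
   convex and does not meet the plane spanned by t and y. This forces the
   differential of G to take both signs on C(Omega, p). *)
Require Import Defs.
From mathcomp Require Import ring lra.

Set Implicit Arguments.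
Unset Strict Implicit.
Unset Printing Implicit Defensive.

Local Open Scope classical_set_scope.
Local Open Scope ring_scope.

(** * Cones of interior directions *)

Section Cones.
Context {R : realType} {V : normedModType R}.
Implicit Types (D E : set V) (p q u w x y : V) (e s : R).

Lemma near_normP x (P : set V) :
  nbhs x P <-> exists2 e, 0 < e & forall y, `|y - x| < e -> P y.
Proof.
split=> [/nbhs_normP[e e0 H]|[e e0 H]].
  by exists e => // y yx; apply: H; rewrite /ball_/= distrC.
by apply/nbhs_normP; exists e => // y; rewrite /ball_/= distrC; exact: H.
Qed.

Lemma open_normP D : open D <->
  forall x, D x -> exists2 e, 0 < e & forall y, `|y - x| < e -> D y.
Proof.
rewrite openE; split=> H x Dx; first exact/near_normP/H.
exact/near_normP/H.
Qed.

Lemma closure_normP D x : closure D x <->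
  forall e, 0 < e -> exists2 y, D y & `|y - x| < e.
Proof.
split=> [H e e0|H B /near_normP[e e0 eB]].
  have /H[y [Dy yx]] : nbhs x [set y | `|y - x| < e] by apply/near_normP; exists e.
  by exists y.
by have [y Dy yx] := H _ e0; exists y; split => //; exact: eB.
Qed.

Lemma boundary_open D p : open D -> boundary D p <-> closure D p /\ ~ D p.
Proof. by move=> oD; rewrite /boundary ((interior_id D).1 oD). Qed.

(** The single radius [e] limits the base point, the direction and the step. Steps go along [- w],
    so for a hypograph the upward vertical is such a [u], pointing out of [D]. *)
Definition cone_at D p u e := forall x w s,
  D x -> `|x - p| < e -> `|w - u| < e -> 0 < s < e -> D (x - s *: w).

Definition cone_dir D p u := exists2 e, 0 < e & cone_at D p u e.

Lemma cone_at_le D p u e e' : e' <= e -> cone_at D p u e -> cone_at D p u e'.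
Proof.
move=> le H x w s Dx xp wu /andP[s0 se]; apply: H => //.
- exact: lt_le_trans le.
- exact: lt_le_trans le.
- by rewrite s0 (lt_le_trans se).
Qed.

Lemma cone_at_shift D p u q w e : `|q - p| <= e / 2 -> `|w - u| <= e / 2 ->
  cone_at D p u e -> cone_at D q w (e / 2).
Proof.
move=> qp wu H x z s Dx xq zw /andP[s0 se]; apply: H => //.
- by have := ler_distD q x p; lra.
- by have := ler_distD w z u; lra.
- by rewrite s0/=; lra.
Qed.

Lemma cone_at_dir_near D p u e : 0 < e -> cone_at D p u e ->
  forall q w, `|q - p| <= e / 2 -> `|w - u| <= e / 2 -> cone_dir D q w.
Proof. by move=> e0 H q w qp wu; exists (e / 2); [lra|exact: cone_at_shift H]. Qed.

Lemma cone_dir_open D p u : cone_dir D p u ->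
  exists2 e, 0 < e & forall w, `|w - u| < e -> cone_dir D p w.
Proof.
move=> [e e0 H]; exists (e / 2) => [|w wu]; first lra.
by apply: (cone_at_dir_near e0 H); rewrite ?subrr ?normr0; lra.
Qed.

(** Since [|w| < |u| + 1], steps below [e / (|u| + 1)] suffice. The bound is uniform in [w] and
    keeps moved points in a given ball. *)
Lemma small_step u e : 0 < e -> exists2 d, 0 < d <= e & forall s w,
  `|w - u| < d -> 0 < s < d -> `|s *: w| < e.
Proof.
move=> e0; have n0 := normr_ge0 u.
exists (Num.min e (Num.min 1 (e / (`|u| + 1)))).
  by rewrite !lt_min e0 ltr01 divr_gt0// ?ge_min ?lexx//; lra.
move=> s w; rewrite !lt_min => /andP[we /andP[w1 _]] /andP[s0].
move=> /andP[se /andP[s1 s2]].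
rewrite normrZ gtr0_norm//.
have wu : `|w| < `|u| + 1.
  by have := lerB_dist w u; lra.
move: s2; rewrite ltr_pdivlMr; last lra.
move=> s2; have := normr_ge0 w; nra.
Qed.

(** A step along [z] near [u + w] is a step along [u] followed by one along [z - u], which is near
    [w]. *)
Lemma cone_dirD D p u w : cone_dir D p u -> cone_dir D p w ->
  cone_dir D p (u + w).
Proof.
move=> [a a0 Ha] [b b0 Hb].
have m0 : 0 < Num.min a (b / 2) by rewrite lt_min a0; lra.
have [d /andP[d0 dm] dP] := small_step u m0.
exists d => // x z s Dx xp zuw ss.
have [? ?] : d <= a /\ d <= b / 2 by move: dm; rewrite le_min => /andP[].
have -> : x - s *: z = (x - s *: u) - s *: (z - u).
  by rewrite scalerBr opprB addrA subrK.
have s0 : 0 < s < d by [].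
have us : `|s *: u| < b / 2.
  have := dP s u; rewrite subrr normr0 lt_min => /(_ d0 ss) /andP[]//.
move: (ss) => /andP[? ?].
apply: Hb.
- by apply: Ha => //; rewrite ?subrr ?normr0//; lra.
- rewrite addrAC; have := ler_normB (x - p) (s *: u); lra.
- have -> : z - u - w = z - (u + w) by rewrite opprD addrA.
  lra.
- by apply/andP; split; lra.
Qed.

Lemma cone_dirZ D p u (c : R) : 0 < c -> cone_dir D p u -> cone_dir D p (c *: u).
Proof.
move=> c0 [e e0 H].
exists (Num.min e (Num.min (e * c) (e / c))).
  by rewrite !lt_min e0 mulr_gt0// divr_gt0.
move=> x w s Dx; rewrite !lt_min => /andP[xp _] /andP[_ /andP[wu _]].
move=> /and4P[s0 _ _ sc].
have -> : s *: w = (s * c) *: (c^-1 *: w) by rewrite scalerA mulfK// gt_eqF.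
apply: H => //.
- rewrite -(@ltr_pM2l _ c)// -[ltLHS](_ : `|c *: (c^-1 *: w - u)| = _).
    by rewrite scalerBr scalerA divff ?gt_eqF// scale1r mulrC.
  by rewrite normrZ gtr0_norm.
- by rewrite mulr_gt0//= -ltr_pdivlMr.
Qed.

(** Replace [x] by a point [y] of [D] so close that the correction [y - x] can be absorbed into the
    direction [w]. The endpoint is unchanged, so it lies in [D] and not only in its closure. *)
Lemma cone_at_closure D p u e x w s : cone_at D p u e -> closure D x ->
  `|x - p| < e -> `|w - u| < e -> 0 < s < e -> D (x - s *: w).
Proof.
move=> H /closure_normP cx xp wu /andP[s0 se].
have m0 : 0 < Num.min (e - `|x - p|) (s * (e - `|w - u|)).
  by rewrite lt_min subr_gt0 xp mulr_gt0// subr_gt0.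
have [y Dy] := cx _ m0; rewrite lt_min => /andP[y1 y2].
have -> : x - s *: w = y - s *: (w + s^-1 *: (y - x)).
  rewrite scalerDr scalerA divff ?gt_eqF// scale1r opprD opprB.
  by rewrite [RHS]addrC -addrA subrK addrC.
apply: H => //.
- by have := ler_distD x y p; lra.
- rewrite addrAC; apply: le_lt_trans (ler_normD _ _) _.
  rewrite normrZ gtr0_norm ?invr_gt0// -ltrBrDl mulrC ltr_pdivrMr//.
  by rewrite mulrC.
- by rewrite s0.
Qed.

(** A step along [u] from [p + s *: u], were it in the closure, would end at [p] and put [p] in
    [D]. *)
Lemma cone_dir_notin_closure D p u : ~ D p -> cone_dir D p u ->
  exists2 e, 0 < e & forall s, 0 < s < e -> ~ closure D (p + s *: u).
Proof.
move=> nDp [e e0 H]; have [d /andP[d0 de] dP] := small_step u e0.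
exists d => // s /[dup] sd /andP[s0 se] cD; apply: nDp.
rewrite -(addrK (s *: u) p); apply: (cone_at_closure H cD).
- by rewrite addrAC subrr add0r; apply: dP => //; rewrite subrr normr0.
- by rewrite subrr normr0.
- by rewrite s0 (lt_le_trans se).
Qed.

(** If a step along [w] near [- u] led from outside the closure into it, the reverse step, along
    [- w] near [u], would put the starting point in [D]. *)
Lemma cone_dir_setC_closure D p u : cone_dir D p u ->
  cone_dir (~` closure D) p (- u).
Proof.
move=> [e e0 H].
have e20 : 0 < e / 2 by lra.
have [d /andP[d0 de] dP] := small_step (- u) e20.
exists d => // x w s Dx xp wu ss cD; apply: Dx; apply: subset_closure.
move: (ss) => /andP[s0 sd].
have -> : x = (x - s *: w) - s *: (- w) by rewrite scalerN opprK subrK.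
apply: (cone_at_closure H cD).
- have := dP s w wu ss; rewrite addrAC; have := ler_normB (x - p) (s *: w); lra.
- by rewrite -opprD normrN -[u in w + u]opprK; lra.
- by apply/andP; split; lra.
Qed.

Lemma cone_dirI D E p u : cone_dir D p u -> cone_dir E p u ->
  cone_dir (D `&` E) p u.
Proof.
move=> [a a0 Ha] [b b0 Hb]; exists (Num.min a b); first by rewrite lt_min a0.
move=> x w s [Dx Ex] xp wu ss; split.
- by apply: (cone_at_le _ Ha) ss => //; rewrite ge_min lexx.
- by apply: (cone_at_le _ Hb) ss => //; rewrite ge_min lexx orbT.
Qed.

Lemma cone_dirU D E p u : cone_dir D p u -> cone_dir E p u ->
  cone_dir (D `|` E) p u.
Proof.
move=> [a a0 Ha] [b b0 Hb]; exists (Num.min a b); first by rewrite lt_min a0.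
move=> x w s [Dx|Ex] xp wu ss; [left|right].
- by apply: (cone_at_le _ Ha) ss => //; rewrite ge_min lexx.
- by apply: (cone_at_le _ Hb) ss => //; rewrite ge_min lexx orbT.
Qed.

Lemma cone_dir_local D E p u e : 0 < e ->
  (forall x, `|x - p| < e -> D x <-> E x) -> cone_dir D p u -> cone_dir E p u.
Proof.
move=> e0 DE [a a0 Ha].
have m0 : 0 < Num.min a (e / 2) by rewrite lt_min a0; lra.
have [d /andP[d0 +] dP] := small_step u m0.
rewrite le_min => /andP[da de].
exists d => // x w s Ex xp wu ss; apply/DE.
  have := dP s w wu ss; rewrite lt_min => /andP[_].
  rewrite addrAC; have := ler_normB (x - p) (s *: w); lra.
by apply: (cone_at_le da Ha) => //; apply/DE => //; lra.
Qed.

Lemma cone_dir_full D p u e : 0 < e -> (forall x, `|x - p| < e -> D x) ->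
  cone_dir D p u.
Proof.
move=> e0 H; apply: (@cone_dir_local setT _ _ _ e) => // [x /H|]; first by [].
by exists 1.
Qed.

Lemma cone_dir_empty D p u e : 0 < e -> (forall x, `|x - p| < e -> ~ D x) ->
  cone_dir D p u.
Proof. by move=> e0 H; exists e => // x w s Dx /H. Qed.

Lemma cone_dir_neq0 D p u : boundary D p -> open D -> cone_dir D p u -> u != 0.
Proof.
move=> + oD => /(boundary_open _ oD) [/closure_normP cD nD] [e e0 H].
apply/eqP => u0; apply: nD.
have m0 : 0 < Num.min e (e * (e / 2)) by rewrite lt_min e0 mulr_gt0//; lra.
have [x Dx] := cD _ m0; rewrite lt_min => /andP[xp xp2].
have s0 : 0 < e / 2 by lra.
(* If [u = 0], every short vector is an allowed direction, in particular the one leading from a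
   nearby [x] in [D] to [p]. *)
have -> : p = x - (e / 2) *: ((e / 2)^-1 *: (x - p)).
  by rewrite scalerA divff ?gt_eqF// scale1r opprB addrCA subrr addr0.
apply: H => //; last by rewrite s0/=; lra.
by rewrite u0 subr0 normrZ gtr0_norm ?invr_gt0// mulrC ltr_pdivrMr.
Qed.

Definition fatten D e : set V := [set x | exists2 y, D y & `|x - y| < e].

Lemma open_fatten D e : open (fatten D e).
Proof.
apply/open_normP => x [y Dy xy]; exists (e - `|x - y|) => [|z zx]; first lra.
by exists y => //; have := ler_distD x z y; lra.
Qed.

(** The step is made from a nearby point of [D]; translating both points by the same vector keeps
    their distance. *)
Lemma cone_at_fatten D p u e d : d <= e / 2 -> cone_at D p u e ->
  cone_at (fatten D d) p u (e / 2).
Proof.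
move=> de H x w s [y Dy xy] xp wu /andP[s0 se]; exists (y - s *: w).
  apply: H => //; last by rewrite s0/=; lra.
  - by have := ler_distD x y p; rewrite (distrC y x); lra.
  - lra.
by rewrite opprB addrA subrK.
Qed.

(** The boundary point is at the supremum of the parameters for which the segment from [x] to [y] is
    in [D]. *)
Lemma segment_boundary D x y : open D -> D x -> ~ D y ->
  exists2 z, boundary D z & `|z - y| <= `|x - y|.
Proof.
move=> oD Dx nDy.
pose f (t : R) := x + t *: (y - x).
pose T := [set t : R | 0 <= t <= 1 /\ D (f t)].
have T0 : T 0 by split; rewrite ?lexx ?ler01// /f scale0r addr0.
have supT : has_sup T by split; [exists 0|exists 1 => t [/andP[]]].
have fE (t t' : R) : f t' - f t = (t' - t) *: (y - x).
  by rewrite /f opprD addrACA subrr add0r scalerBl.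
have s0 : 0 <= sup T by apply: ub_le_sup => //; exact: supT.2.
have s1 : sup T <= 1 by apply: ge_sup; [exact: supT.1|move=> t [/andP[]]].
have n0 : 0 < `|y - x| + 1 by have := normr_ge0 (y - x); lra.
have f1 : f 1 = y by rewrite /f scale1r addrC subrK.
exists (f (sup T)); last first.
  rewrite -[X in `|_ - X| <= _]f1 fE normrZ distrC ger0_norm ?subr_ge0//.
  by rewrite (distrC x) ler_piMl//; lra.
apply/boundary_open => //; split.
  apply/closure_normP => e e0.
  have [t [t01 Dt] tT] := sup_adherent (divr_gt0 e0 n0) supT.
  exists (f t) => //; rewrite fE normrZ.
  have tle : t <= sup T by apply: ub_le_sup => //; exact: supT.2.
  rewrite distrC ger0_norm ?subr_ge0//.
  have : sup T - t < e / (`|y - x| + 1) by lra.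
  rewrite ltr_pdivlMr//; have := normr_ge0 (y - x); nra.
move=> Ds; have := (open_normP D).1 oD _ Ds => -[e e0 eD].
have s1' : sup T < 1.
  rewrite lt_neqAle s1 andbT; apply/eqP => sE; apply: nDy.
  by move: Ds; rewrite sE f1.
pose t := Num.min 1 (sup T + e / (2 * (`|y - x| + 1))).
have e20 : 0 < e / (2 * (`|y - x| + 1)) by rewrite divr_gt0// mulr_gt0.
have st : sup T < t by rewrite lt_min s1'/= ltrDl.
suff : T t by move=> /(ub_le_sup supT.2); rewrite leNgt st.
split; first by rewrite ge_min lexx /= (le_trans s0 (ltW st)).
apply: eD; rewrite fE normrZ gtr0_norm ?subr_gt0//.
have : t - sup T <= e / (2 * (`|y - x| + 1)).
  by rewrite lerBlDl ge_min lexx orbT.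
rewrite ler_pdivlMr ?mulr_gt0//; have := normr_ge0 (y - x); nra.
Qed.

End Cones.

(** * Orthogonal frames of R^3 *)

Section Frames.
Context {R : realType}.
Local Notation E3 := 'rV[R]_3.
Implicit Types (x y z p u : E3) (Q : 'M[R]_3) (a b c e : R).

Definition mk3 a b c : E3 := \row_(i < 3) [:: a; b; c]`_i.

Lemma mk3E a b c : (mk3 a b c 0 0 = a) * (mk3 a b c 0 1 = b) * (mk3 a b c 0 2 = c).
Proof. by rewrite /mk3 !mxE. Qed.

Lemma ord3P (P : 'I_3 -> Prop) : P 0 -> P 1 -> P 2 -> forall i, P i.
Proof.
move=> P0 P1 P2 [[|[|[|//]]] Hi].
- by rewrite (_ : Ordinal Hi = 0)//; exact/val_inj.
- by rewrite (_ : Ordinal Hi = 1)//; exact/val_inj.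
- by rewrite (_ : Ordinal Hi = 2)//; exact/val_inj.
Qed.

Lemma row3P x y : x 0 0 = y 0 0 -> x 0 1 = y 0 1 -> x 0 2 = y 0 2 -> x = y.
Proof. by move=> *; apply/rowP; exact: ord3P. Qed.

Lemma mk3_coords x : mk3 (x 0 0) (x 0 1) (x 0 2) = x.
Proof. by apply: row3P; rewrite mk3E. Qed.

Lemma sum3E (F : 'I_3 -> R) : \sum_i F i = F 0 + F 1 + F 2.
Proof.
rewrite !big_ord_recr big_ord0 /= add0r.
by congr (F _ + F _ + F _); exact/val_inj.
Qed.

Lemma coord_le_norm x i : `|x 0 i| <= `|x|.
Proof.
rewrite [leRHS]/Num.Def.normr/= mx_normrE.
exact: (le_bigmax _ (fun ij : 'I_1 * 'I_3 => `|x ij.1 ij.2|) (0, i)).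
Qed.

Lemma norm3_le x e : `|x 0 0| <= e -> `|x 0 1| <= e -> `|x 0 2| <= e -> `|x| <= e.
Proof.
move=> x0 x1 x2; have e0 : 0 <= e by exact: le_trans x0.
rewrite [leLHS]/Num.Def.normr/= mx_normrE; apply: bigmax_le => //= -[i j] _ /=.
by rewrite (ord1 i); move: j; exact: ord3P.
Qed.

Definition orthogonal Q := Q *m Q^T = 1%:M.

Lemma orthogonal_tr Q : orthogonal Q -> orthogonal Q^T.
Proof. by rewrite /orthogonal trmxK => /mulmx1C. Qed.

Lemma orthogonal_entry Q i j : orthogonal Q -> `|Q i j| <= 1.
Proof.
move=> /(congr1 (fun M : 'M[R]_3 => M i i)); rewrite !mxE eqxx mulr1n => H.
have : Q i j ^+ 2 <= 1.
  rewrite -H (bigD1 j)//= mxE expr2 lerDl sumr_ge0// => k _.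
  by rewrite mxE -expr2 sqr_ge0.
by rewrite -(real_normK (num_real (Q i j))) expr_le1.
Qed.

(** Each coordinate is a sum of three terms, with entries of [Q] at most 1 in absolute value. The
    factor 3 comes from using the sup norm. *)
Lemma norm_mul_orthogonal Q x : orthogonal Q -> `|x *m Q| <= 3 * `|x|.
Proof.
move=> oQ.
suff H i : `|(x *m Q) 0 i| <= 3 * `|x| by apply: norm3_le.
rewrite mxE sum3E.
have B j : `|x 0 j * Q j i| <= `|x|.
  rewrite normrM; apply: le_trans (coord_le_norm x j).
  by rewrite ler_piMr ?orthogonal_entry.
have := ler_normD (x 0 0 * Q 0 i + x 0 1 * Q 1 i) (x 0 2 * Q 2 i).
have := ler_normD (x 0 0 * Q 0 i) (x 0 1 * Q 1 i).
by move: (B 0) (B 1) (B 2); lra.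
Qed.

Definition loc p Q x : E3 := (x - p) *m Q^T.

Lemma loc_frame p Q x : orthogonal Q -> loc p Q (frame_point p Q x) = x.
Proof. by move=> oQ; rewrite /loc /frame_point addrC addKr -mulmxA oQ mulmx1. Qed.

Lemma frame_loc p Q x : orthogonal Q -> frame_point p Q (loc p Q x) = x.
Proof.
move=> oQ; rewrite /loc /frame_point -mulmxA (mulmx1C oQ) mulmx1.
by rewrite addrC subrK.
Qed.

Lemma locB p Q x y : loc p Q x - loc p Q y = (x - y) *m Q^T.
Proof. by rewrite /loc -mulmxBl opprB addrA subrK. Qed.

Lemma loc_step p Q x (s : R) w :
  loc p Q (x - s *: w) = loc p Q x - s *: (w *m Q^T).
Proof. by rewrite /loc addrAC mulmxBl -scalemxAl. Qed.

Lemma coordB x y i : (x - y) 0 i = x 0 i - y 0 i.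
Proof. by rewrite !mxE. Qed.

Lemma coordD x y i : (x + y) 0 i = x 0 i + y 0 i.
Proof. by rewrite !mxE. Qed.

Lemma coordZ a x i : (a *: x) 0 i = a * x 0 i.
Proof. by rewrite !mxE. Qed.

Lemma stepE x (s : R) w i : (x - s *: w) 0 i = x 0 i - s * w 0 i.
Proof. by rewrite !mxE. Qed.

Lemma locpp p Q : loc p Q p = 0.
Proof. by rewrite /loc subrr mul0mx. Qed.

Lemma loc_lip p Q x y : orthogonal Q ->
  `|loc p Q x - loc p Q y| <= 3 * `|x - y|.
Proof. by move=> oQ; rewrite locB; apply/norm_mul_orthogonal/orthogonal_tr. Qed.

Lemma frameB p Q x y : frame_point p Q x - frame_point p Q y = (x - y) *m Q.
Proof. by rewrite /frame_point opprD addrACA subrr add0r mulmxBl. Qed.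

Lemma frame_lip p Q x y : orthogonal Q ->
  `|frame_point p Q x - frame_point p Q y| <= 3 * `|x - y|.
Proof. by move=> oQ; rewrite frameB; exact: norm_mul_orthogonal. Qed.

Lemma frame0 p Q : frame_point p Q 0 = p.
Proof. by rewrite /frame_point mul0mx addr0. Qed.

Lemma mk3_mul a b c Q :
  mk3 a b c *m Q = a *: row 0 Q + b *: row 1 Q + c *: row 2 Q.
Proof. by apply/rowP => i; rewrite !mxE sum3E !mk3E. Qed.

Lemma row_mulT Q : orthogonal Q ->
  (row 0 Q *m Q^T = mk3 1 0 0) * (row 1 Q *m Q^T = mk3 0 1 0) *
  (row 2 Q *m Q^T = mk3 0 0 1).
Proof.
move=> oQ; rewrite -!row_mul oQ !row1.
by split; [split|]; apply: row3P; rewrite !mk3E !mxE.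
Qed.

Lemma unit_frame u : unit_vector u -> exists2 Q, orthogonal Q & row 2 Q = u.
Proof.
rewrite /unit_vector sum3E => hu.
pose Q r0 r1 r2 : 'M[R]_3 := \matrix_(i < 3) [:: r0; r1; r2 : E3]`_i.
have QP (r0 r1 r2 : E3) : (forall i j : 'I_3, \sum_k [:: r0; r1; r2]`_i 0 k * [:: r0; r1; r2]`_j 0 k = (i == j)%:R) ->
    orthogonal (Q r0 r1 r2).
  move=> H; apply/matrixP => i j; rewrite !mxE -H.
  by apply: eq_bigr => k _; rewrite !mxE.
set a := u 0 0 in hu; set b := u 0 1 in hu; set c := u 0 2 in hu.
(* The general formula divides by [1 + c]; the excluded vector is minus the third basis vector,
   completed by the first two. *)
have [c1|c1] := eqVneq c (-1).
  have ab : a ^+ 2 + b ^+ 2 = 0.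
    by rewrite -[LHS](addrK (c ^+ 2)) hu c1 sqrrN expr1n subrr.
  have a0 : a = 0.
    by apply/eqP; rewrite -sqrf_eq0; apply/eqP; have := sqr_ge0 a; have := sqr_ge0 b; lra.
  have b0 : b = 0.
    by apply/eqP; rewrite -sqrf_eq0; apply/eqP; have := sqr_ge0 a; have := sqr_ge0 b; lra.
  exists (Q (mk3 1 0 0) (mk3 0 1 0) u).
    by apply: QP; apply: ord3P; apply: ord3P; rewrite sum3E /= ?mk3E -?/a -?/b -?/c ?a0 ?b0 ?c1 /=; ring.
  by apply/rowP => i; rewrite !mxE.
have c10 : 1 + c != 0 by rewrite addrC addr_eq0.
have cE : c ^+ 2 = 1 - a ^+ 2 - b ^+ 2 by lra.
(* This is the rotation that takes [u] to the third basis vector and fixes the vectors orthogonal to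
   both. *)
exists (Q (mk3 (1 - a ^+ 2 / (1 + c)) (- (a * b) / (1 + c)) (- a))
          (mk3 (- (a * b) / (1 + c)) (1 - b ^+ 2 / (1 + c)) (- b)) u).
  apply: QP; apply: ord3P; apply: ord3P; rewrite sum3E /= ?mk3E -?/a -?/b -?/c /=;
    first [by field: cE | by ring: cE].
by apply/rowP => i; rewrite !mxE.
Qed.

End Frames.

(** * Hypographs and cones *)

Section LipschitzBound.
Context {R : realType} {V W : normedModType R}.

Lemma lipschitz_boundP (f : V -> W) (A : set V) :
  [lipschitz f x | x in A] <->
  exists2 L : R, 0 < L & forall x y, A x -> A y -> `|f x - f y| <= L * `|x - y|.
Proof.
split=> [[M [_ H]]|[L L0 H]].
  exists (Num.max 1 (M + 1)); first by rewrite lt_max ltr01.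
  move=> x y Ax Ay; apply: (H _ _ (x, y)) => //.
  by rewrite lt_max; apply/orP; right; lra.
exists L; split; first exact: num_real.
move=> M LM [x y] [/= Ax Ay]; apply: le_trans (H _ _ Ax Ay) _.
by rewrite ler_wpM2r// ltW.
Qed.
End LipschitzBound.

Section Hypograph.
Context {R : realType}.
Local Notation E3 := 'rV[R]_3.
Implicit Types (D : set E3) (x y p u : E3) (Q : 'M[R]_3).

Lemma coord_box_norm (r h : R) x : `|x| < r -> `|x| < h -> coord_box r h x.
Proof.
move=> xr xh; split; rewrite in_itv/= -ltr_norml.
- exact: le_lt_trans (coord_le_norm x _) xr.
- exact: le_lt_trans (coord_le_norm x _) xr.
- exact: le_lt_trans (coord_le_norm x _) xh.
Qed.

Lemma coord_boxP (r h : R) x :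
  coord_box r h x <-> [/\ `|x 0 0| < r, `|x 0 1| < r & `|x 0 2| < h].
Proof. by rewrite /coord_box/= !in_itv/= -!ltr_norml; split=> -[]. Qed.

Lemma box_traceP p Q (r h : R) (S : set E3) (A : set E3) :
  box_trace p Q r h S = coord_box r h `&` A <->
  forall x, coord_box r h x -> S (frame_point p Q x) <-> A x.
Proof.
split=> [H x bx|H].
  have := congr1 (fun B : set E3 => B x) H; rewrite /box_trace /= => E.
  split=> Sx.
    by have [] : (coord_box r h x /\ A x) by rewrite -E.
  by have [] : (coord_box r h x /\ S (frame_point p Q x)) by rewrite E.
apply/seteqP; split=> x [bx Sx]; split => //; exact/(H _ bx).
Qed.

Lemma hypograph_cone D p Q (r h : R) zeta :
  hypograph_in_box D p Q r h zeta -> cone_dir D p (row 2 Q).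
Proof.
move=> [[oQ r0 h0] /lipschitz_boundP[L L0 zL] _ _ [/box_traceP HD _ _]].
set m := Num.min r h.
have m0 : 0 < m by rewrite lt_min r0.
have [mr mh] : m <= r /\ m <= h by rewrite !ge_min !lexx orbT.
(* The bound [m / 12] keeps both ends of the step in the box. The other bound makes the descent, at
   least [s * (1 - 3 * e)], exceed the variation of [zeta], at most [L * (s * (3 * e))]. *)
pose e := Num.min (m / 12) (4 * (1 + L))^-1.
have e0 : 0 < e by rewrite lt_min divr_gt0//= invr_gt0; lra.
have em : e <= m / 12 by rewrite ge_min lexx.
have eL : e * (4 * (1 + L)) <= 1.
  by rewrite -ler_pdivlMr ?div1r ?ge_min ?lexx ?orbT//; lra.
exists e => // x w s Dx xp wu /andP[s0 se].
have oQ' : orthogonal Q by [].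
have X1 : `|loc p Q x| <= 3 * `|x - p|.
  by have := loc_lip p x p oQ'; rewrite locpp subr0.
rewrite -(frame_loc p x oQ') in Dx.
rewrite -(frame_loc p (x - s *: w) oQ').
rewrite loc_step; set X := loc p Q x in X1 Dx *; set W := w *m Q^T.
have W1 : `|W - mk3 0 0 1| <= 3 * `|w - row 2 Q|.
  have := norm_mul_orthogonal (w - row 2 Q) (orthogonal_tr oQ').
  by rewrite mulmxBl (row_mulT oQ').
have Wi i : `|W 0 i - mk3 0 0 1 0 i| <= 3 * e.
  have := coord_le_norm (W - mk3 0 0 1) i; rewrite !mxE; lra.
have := Wi 0; have := Wi 1; have := Wi 2; rewrite !mk3E !subr0.
move=> W2 Wa Wb.
have e1 : 4 * e <= 1 by nra.
have bX : coord_box r h X by apply: coord_box_norm; lra.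
have Xi i : `|X 0 i| <= 3 * `|x - p| by apply: le_trans X1; exact: coord_le_norm.
have W2' : `|W 0 2| <= 2.
  by have := ler_distD (W 0 2) 1 0; have := ler_normD (W 0 2 - 1) 1; rewrite subrK normr1; lra.
have sW i : `|W 0 i| <= 2 -> `|(X - s *: W) 0 i| < m.
  move=> Wl; rewrite stepE; apply: le_lt_trans (ler_normB _ _) _.
  by rewrite normrM gtr0_norm//; have := Xi i; nra.
have [bX0 bX1 bX2] : [/\ `|(X - s *: W) 0 0| < m, `|(X - s *: W) 0 1| < m & `|(X - s *: W) 0 2| < m].
  by split; apply: sW; lra.
have bX' : coord_box r h (X - s *: W).
  by apply/coord_boxP; split; [exact: lt_le_trans mr|exact: lt_le_trans mr|exact: lt_le_trans mh].
apply/(HD _ bX') => /=; move/(HD _ bX) : Dx => /= XZ.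
have sq (Y : E3) : coord_box r h Y -> (`[-r, r] `*` `[-r, r]) (Y 0 0, Y 0 1).
  by move=> /coord_boxP[/ltW Y0 /ltW Y1 _]; split; rewrite /= in_itv/= -ler_norml.
have := zL _ _ (sq _ bX) (sq _ bX').
rewrite prod_normE /=.
have -> : (X 0 0 - (X - s *: W) 0 0) = s * W 0 0 by rewrite stepE opprB addrC subrK.
have -> : (X 0 1 - (X - s *: W) 0 1) = s * W 0 1 by rewrite stepE opprB addrC subrK.
have -> : (X - s *: W) 0 2 = X 0 2 - s * W 0 2 by rewrite stepE.
have mW : Num.max `|s * W 0 0| `|s * W 0 1| <= s * (3 * e).
  by rewrite ge_max !normrM (gtr0_norm s0) !ler_pM2l// Wa Wb.
move=> zz; move: W2; rewrite ler_distl => /andP[W2 _].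
have LM : L * Num.max `|s * W 0 0| `|s * W 0 1| <= L * (s * (3 * e)) by rewrite ler_pM2l.
have {zz} : `|zeta (X 0 0, X 0 1) - zeta ((X - s *: W) 0 0, (X - s *: W) 0 1)| <= L * (s * (3 * e)).
  exact: le_trans LM.
rewrite ler_distl => /andP[z1 z2].
have : s * (1 - 3 * e) <= s * W 0 2 by rewrite ler_pM2l//; lra.
have : s * (e * (4 * (1 + L))) <= s by rewrite -[leRHS]mulr1 ler_pM2l.
have : 0 < s * e by rewrite mulr_gt0.
have : 0 < s * (e * L) by rewrite !mulr_gt0.
by lra.
Qed.

End Hypograph.

(** * Sets with a vertical cone condition are hypographs of Lipschitz functions *)

Section ConeGraph.
Context {R : realType}.
Local Notation E3 := 'rV[R]_3.
Implicit Types X Y : E3.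
Variables (P : set E3) (k b : R).
Hypotheses (k0 : 0 < k) (b0 : 0 < b).
(** The cone condition in local coordinates: from a point of [P] near the origin one may descend
    within a vertical cone of half-width [k] per unit of height. *)
Hypothesis step : forall X Y, P X -> `|X| <= b -> Y 0 2 < X 0 2 ->
  X 0 2 - Y 0 2 <= 2 * b -> `|Y 0 0 - X 0 0| <= k * (X 0 2 - Y 0 2) ->
  `|Y 0 1 - X 0 1| <= k * (X 0 2 - Y 0 2) -> P Y.
Hypotheses (oP : open P) (clP0 : closure P 0) (nP0 : ~ P 0).

(* The slack delta leaves room to replace X by a point of P. *)
Lemma step_closure X Y (delta : R) : closure P X -> `|X| <= b / 2 -> 0 < delta ->
  delta <= b / 2 -> Y 0 2 + delta < X 0 2 -> X 0 2 - Y 0 2 + delta <= 2 * b ->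
  `|Y 0 0 - X 0 0| + delta <= k * (X 0 2 - Y 0 2 - delta) ->
  `|Y 0 1 - X 0 1| + delta <= k * (X 0 2 - Y 0 2 - delta) -> P Y.
Proof.
move=> /closure_normP cX Xb d0 db X2 XY Y0 Y1.
have [Z PZ ZX] := cX _ d0.
have Zi i : `|Z 0 i - X 0 i| <= delta.
  by rewrite -coordB; apply: le_trans (coord_le_norm _ _) (ltW ZX).
have := Zi 2; rewrite ler_distl => /andP[Z2l Z2u].
have kZ : k * (X 0 2 - Y 0 2 - delta) <= k * (Z 0 2 - Y 0 2).
  by rewrite ler_pM2l//; lra.
apply: (step PZ); try lra.
- have := ler_distD X Z 0; rewrite !subr0; lra.
- by have := ler_distD (X 0 0) (Y 0 0) (Z 0 0); have := Zi 0; rewrite (distrC (Z 0 0)); lra.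
- by have := ler_distD (X 0 1) (Y 0 1) (Z 0 1); have := Zi 1; rewrite (distrC (Z 0 1)); lra.
Qed.

(** These points are strictly inside the downward cone with apex at the origin, hence inside that of
    a point of [P] close to the origin. *)
Lemma below_cone X (c : R) : `|X| <= b -> 0 <= c -> `|X 0 0| <= c ->
  `|X 0 1| <= c -> X 0 2 < - (c / k) -> P X.
Proof.
move=> Xb c0 X0 X1 X2; move: (k0) (b0) => k0' b0'.
(* The second bound says that the slack costs at most half of the margin by which [X] is inside the
   cone. *)
pose d := Num.min (b / 2) (k * (- (c / k) - X 0 2) / (2 * (1 + k))).
have d0 : 0 < d.
  by rewrite lt_min divr_gt0//= divr_gt0 ?mulr_gt0 ?subr_gt0//; lra.
have [db dk] : d <= b / 2 /\ d <= k * (- (c / k) - X 0 2) / (2 * (1 + k)).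
  by rewrite !ge_min !lexx orbT.
move: dk; rewrite ler_pdivlMr; last by lra.
have ck : k * (c / k) = c by rewrite mulrC divfK// gt_eqF.
rewrite mulrBr mulrN ck => dk.
have dk0 : 0 < d * k by rewrite mulr_gt0.
have ck0 : 0 <= c / k by rewrite divr_ge0// ltW.
have := coord_le_norm X 2; rewrite ler_norml => /andP[X2l X2u].
have d2 : X 0 2 + d < 0.
  rewrite -(ltr_pM2l k0) mulr0; lra.
by apply: (step_closure clP0 _ d0) => //; rewrite ?mxE ?normr0 ?subr0 ?sub0r; lra.
Qed.

(** The downward cone of such an [X] contains the origin, which is not in [P]. *)
Lemma above_cone X (c : R) : `|X| <= b -> `|X 0 0| <= c -> `|X 0 1| <= c ->
  0 < X 0 2 -> c <= k * X 0 2 -> ~ P X.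
Proof.
move=> Xb X0 X1 X2 cX PX; apply: nP0.
apply: (step PX) => //; rewrite !mxE ?subr0 ?sub0r ?normrN//; try lra.
by have := coord_le_norm X 2; have := ler_norm (X 0 2); move: (b0) => b0'; lra.
Qed.

(** Over the square of half-side [r] the cones at the origin reach heights up to [q = r / k], so the
    graph is confined between [- q] and [q]. The bounds [r <= b / 2] and [q <= b / 8] keep all
    constructions in the ball of radius [b]. *)
Let r := Num.min (b / 2) (k * (b / 8)).
Let q := r / k.

Local Lemma rq_bounds : [/\ 0 < r, r <= b / 2, 0 < q, q <= b / 8 & k * q = r].
Proof.
have r0 : 0 < r by rewrite lt_min divr_gt0//= mulr_gt0// divr_gt0.
split => //.
- by rewrite ge_min lexx.
- by rewrite divr_gt0.
- by rewrite ler_pdivrMr// mulrC ge_min lexx orbT.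
- by rewrite mulrC divfK// gt_eqF.
Qed.

Let slice (y : R * R) := [set t : R | `|t| <= b /\ P (mk3 y.1 y.2 t)].
Let zeta (y : R * R) : R := sup (slice y).
Let sq (y : R * R) := `|y.1| <= r /\ `|y.2| <= r.

Local Lemma norm_slice y t : sq y -> `|t| <= b -> `|mk3 y.1 y.2 t| <= b.
Proof.
have [r0 rb _ _ _] := rq_bounds; move: (b0) => b0'.
by move=> [y1 y2] tb; apply: norm3_le; rewrite mk3E//; lra.
Qed.

Local Lemma slice_lt y t : sq y -> slice y t -> t < q.
Proof.
have [r0 _ q0 _ kq] := rq_bounds.
move=> yq [tb Pt]; rewrite ltNge; apply/negP => qt; move: Pt.
have [y1 y2] := yq.
apply: (@above_cone _ r); rewrite ?mk3E//; first exact: norm_slice.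
  by lra.
by rewrite -kq ler_pM2l.
Qed.

Local Lemma slice_below y t : sq y -> `|t| <= b -> t < - q -> P (mk3 y.1 y.2 t).
Proof.
have [r0 _ q0 _ kq] := rq_bounds.
move=> yq tb tq; have [y1 y2] := yq.
by apply: (@below_cone _ r); rewrite ?mk3E//; [exact: norm_slice|exact: ltW].
Qed.

Local Lemma slice_sup y : sq y -> has_sup (slice y).
Proof.
have [r0 _ q0 qb kq] := rq_bounds; move: (b0) => b0'.
move=> yq; split; last by exists q => t /(slice_lt yq)/ltW.
exists (- (3 * q)).
have tb : `|- (3 * q)| <= b by rewrite normrN gtr0_norm; lra.
by split => //; apply: slice_below => //; lra.
Qed.

Local Lemma zeta_le y : sq y -> zeta y <= q.
Proof.
by move=> yq; apply: ge_sup; [exact: (slice_sup yq).1|move=> t /(slice_lt yq)/ltW].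
Qed.

(** Openness of [P] keeps the supremum from being attained, and vertical descents fill everything
    below it. *)
Local Lemma zetaP y t : sq y -> `|t| <= b -> P (mk3 y.1 y.2 t) <-> t < zeta y.
Proof.
have [r0 _ q0 qb _] := rq_bounds; move: (b0) => b0'.
move=> yq tb; split=> [Pt|tz].
  have tq : t < q by apply: (slice_lt yq).
  have [d d0 dP] := (open_normP P).1 oP _ Pt.
  pose g := Num.min (d / 2) (b / 8).
  have g0 : 0 < g by rewrite lt_min !divr_gt0.
  have [gd gb] : g <= d / 2 /\ g <= b / 8 by rewrite !ge_min !lexx orbT.
  suff : slice y (t + g) by move=> /(ub_le_sup (slice_sup yq).2); rewrite -/(zeta y); lra.
  split; first by move: tb; rewrite !ler_norml => /andP[? ?]; apply/andP; split; lra.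
  apply: dP; apply: le_lt_trans (_ : g < d); last lra.
  apply: norm3_le; rewrite coordB !mk3E ?subrr ?normr0 ?(ltW g0)//.
  by rewrite addrAC subrr add0r gtr0_norm.
have tz' : 0 < zeta y - t by rewrite subr_gt0.
have [t' [t'b Pt']] := sup_adherent tz' (slice_sup yq).
rewrite -/(zeta y) opprB addrCA subrr addr0 => tt'.
apply: (step Pt'); rewrite ?mk3E ?subrr ?normr0//.
- exact: norm_slice.
- by move: t'b tb; rewrite !ler_norml => /andP[? ?] /andP[? ?]; lra.
- by rewrite mulr_ge0 ?subr_ge0 ?ltW.
- by rewrite mulr_ge0 ?subr_ge0 ?ltW.
Qed.

Local Lemma zeta_ge y : sq y -> - q <= zeta y.
Proof.
have [r0 _ q0 qb _] := rq_bounds; move: (b0) => b0' yq.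
rewrite leNgt; apply/negP => zl.
(* The midpoint between [zeta y] and [- q] is low enough to be in [P] and yet above [zeta y]; the
   maximum with [- (3 * q)] only keeps it in range. *)
have tb : `|(Num.max (zeta y) (- (3 * q)) - q) / 2| <= b.
  rewrite ler_norml; have [h1|h1] := leP (zeta y) (- (3 * q)); apply/andP; split; lra.
have /(zetaP yq tb) : P (mk3 y.1 y.2 ((Num.max (zeta y) (- (3 * q)) - q) / 2)).
  by apply: slice_below => //; have [h1|h1] := leP (zeta y) (- (3 * q)); lra.
by have [h1|h1] := leP (zeta y) (- (3 * q)); lra.
Qed.

Local Lemma zeta_abs y : sq y -> `|zeta y| <= b / 8.
Proof.
have [_ _ q0 qb _] := rq_bounds => yq.
have := zeta_le yq; have := zeta_ge yq.
by rewrite ler_norml => ? ?; apply/andP; split; lra.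
Qed.

(** Otherwise a point just below the graph over [y] could descend by [n], moving horizontally by
    [k * n = |y - y'|], to a point of [P] above the graph over [y']. The Lipschitz constant is thus
    the inverse of the cone width. *)
Local Lemma zeta_sub_le y y' : sq y -> sq y' -> zeta y - zeta y' <= k^-1 * `|y - y'|.
Proof.
move: (b0) => b0' yq yq'; rewrite leNgt; apply/negP => lt.
have [yy|yy] := eqVneq y y'.
  by move: lt; rewrite yy !subrr normr0 mulr0 ltxx.
have n0 : 0 < k^-1 * `|y - y'| by rewrite mulr_gt0 ?invr_gt0// normr_gt0 subr_eq0.
set n := k^-1 * _ in lt n0.
have kn : k * n = `|y - y'| by rewrite mulrA divff ?gt_eqF// mul1r.
pose t := (zeta y' + n + zeta y) / 2.
have := zeta_abs yq; have := zeta_abs yq'.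
rewrite !ler_norml => /andP[z1 z2] /andP[z3 z4].
have tb : `|t| <= b by rewrite ler_norml /t; apply/andP; split; lra.
have tb' : `|t - n| <= b by rewrite ler_norml /t; apply/andP; split; lra.
have Pt : P (mk3 y.1 y.2 t) by apply/(zetaP yq tb); rewrite /t; lra.
suff /(zetaP yq' tb') : P (mk3 y'.1 y'.2 (t - n)) by rewrite /t; lra.
apply: (step Pt); rewrite ?mk3E ?opprB ?(addrCA t) ?subrr ?addr0 ?kn.
- exact: norm_slice.
- by lra.
- by lra.
- by rewrite (distrC y) prod_normE le_max /= lexx.
- by rewrite (distrC y) prod_normE le_max /= lexx orbT.
Qed.

Local Lemma zeta00 : zeta (0, 0) = 0.
Proof.
have [r0 _ _ _ _] := rq_bounds; move: (b0) => b0'.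
have oq : sq (0, 0) by rewrite /sq /= normr0; split; exact: ltW.
have := zeta_abs oq; rewrite ler_norml => /andP[zl zu].
have tb : `|zeta (0, 0) / 2| <= b by rewrite ler_norml; apply/andP; split; lra.
apply/eqP; rewrite eq_le; apply/andP; split; rewrite leNgt; apply/negP => z0.
  have : P (mk3 0 0 (zeta (0, 0) / 2)) by apply/(zetaP oq tb); lra.
  apply: (@above_cone _ 0); rewrite ?mk3E ?normr0//; first exact: (norm_slice oq).
    by lra.
  by rewrite mulr_ge0// ?ltW//; lra.
suff /(zetaP oq tb) : P (mk3 0 0 (zeta (0, 0) / 2)) by lra.
apply: (@below_cone _ 0); rewrite ?mk3E ?normr0//; first exact: (norm_slice oq).
by rewrite mul0r oppr0; lra.
Qed.

(** From a point of the closure above the graph, a vertical descent by half the excess would reach a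
    point of [P] still above the graph. *)
Local Lemma closure_zeta X : coord_box r (b / 4) X ->
  closure P X <-> X 0 2 <= zeta (X 0 0, X 0 1).
Proof.
have [r0 rb _ _ _] := rq_bounds; move: (b0) (k0) => b0' k0'.
move=> /coord_boxP[X0 X1]; rewrite ltr_norml => /andP[X2l X2u].
have Xq : sq (X 0 0, X 0 1) by split; exact: ltW.
set z := zeta _.
have := zeta_abs Xq; rewrite -/z ler_norml => /andP[zl zu].
split=> [cX|Xz].
  rewrite leNgt; apply/negP => zX.
  pose t := (z + X 0 2) / 2.
  have tb : `|t| <= b by rewrite ler_norml /t; apply/andP; split; lra.
  suff /(zetaP Xq tb) : P (mk3 (X 0 0) (X 0 1) t) by rewrite -/z /t; lra.
  pose d := Num.min (b / 4) (k * (X 0 2 - z) / (4 * (1 + k))).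
  have d0 : 0 < d.
    by rewrite lt_min divr_gt0//= divr_gt0 ?mulr_gt0 ?subr_gt0//; lra.
  have [db] : d <= b / 4 /\ d <= k * (X 0 2 - z) / (4 * (1 + k)).
    by rewrite !ge_min !lexx orbT.
  rewrite ler_pdivlMr; last lra.
  move=> dk; have dk0 : 0 < d * k by rewrite mulr_gt0.
  have dX : d < (X 0 2 - z) / 2 by rewrite -(ltr_pM2l k0); lra.
  have dE : d <= k * (X 0 2 - t - d) by rewrite /t; lra.
  apply: (step_closure cX _ d0); rewrite ?mk3E ?subrr ?normr0 ?add0r//; try by rewrite /t; lra.
  by apply: norm3_le; [lra|lra|rewrite ler_norml; apply/andP; split; lra].
apply/closure_normP => d d0.
pose m := Num.min (b / 4) (d / 2).
have m0 : 0 < m by rewrite lt_min !divr_gt0.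
have [mb md] : m <= b / 4 /\ m <= d / 2 by rewrite !ge_min !lexx orbT.
have tb : `|X 0 2 - m| <= b by rewrite ler_norml; apply/andP; split; lra.
exists (mk3 (X 0 0) (X 0 1) (X 0 2 - m)).
  by apply/(zetaP Xq tb); rewrite -/z; lra.
apply: le_lt_trans (_ : m < d); last lra.
apply: norm3_le; rewrite coordB !mk3E ?subrr ?normr0 ?(ltW m0)//.
by rewrite addrAC subrr add0r normrN gtr0_norm.
Qed.

Lemma cone_graph : exists (r h : R) (zeta : R * R -> R),
  [/\ 0 < r /\ 0 < h, [lipschitz zeta y | y in `[-r, r] `*` `[-r, r] ],
      zeta (0, 0) = 0,
      forall y : R * R, (`]-r, r[ `*` `]-r, r[) y -> `|zeta y| < h &
      forall X, coord_box r h X ->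
        (P X <-> X 0 2 < zeta (X 0 0, X 0 1)) /\
        (closure P X <-> X 0 2 <= zeta (X 0 0, X 0 1))].
Proof.
have [r0 _ _ _ _] := rq_bounds; move: (b0) => b0'.
exists r, (b / 4), zeta; split.
- by split => //; lra.
- apply/lipschitz_boundP; exists k^-1; first by rewrite invr_gt0.
  move=> y y' [/= + +] [/= + +]; rewrite !in_itv/= -!ler_norml => y1 y2 y'1 y'2.
  rewrite ler_norml; apply/andP; split; last exact: zeta_sub_le.
  by rewrite lerNl opprB distrC; exact: zeta_sub_le.
- exact: zeta00.
- move=> y [/=]; rewrite !in_itv/= -!ltr_norml => /ltW y1 /ltW y2.
  by apply: le_lt_trans (zeta_abs _) _ => //; lra.
- move=> X bX; split; last exact: closure_zeta.
  have [X0 X1 X2] := (coord_boxP _ _ _).1 bX.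
  have := @zetaP (X 0 0, X 0 1) (X 0 2); rewrite /= mk3_coords; apply.
    by split; exact: ltW.
  lra.
Qed.

End ConeGraph.

(** * Lipschitz domains characterized by cones *)

Section ConeHypograph.
Context {R : realType}.
Local Notation E3 := 'rV[R]_3.
Implicit Types (D : set E3) (x y p u : E3) (Q : 'M[R]_3).

(** With [s] the descent, [Y = X - s *: W] where [W] is within [e / 4] of the vertical. The frame
    multiplies norms by at most 3, and [3 * (e / 4) < e]. *)
Lemma cone_frame_step D p Q (e : R) : orthogonal Q -> 0 < e ->
  cone_at D p (row 2 Q) e -> forall X Y : E3, D (frame_point p Q X) ->
  `|X| <= e / 4 -> Y 0 2 < X 0 2 -> X 0 2 - Y 0 2 <= 2 * (e / 4) ->
  `|Y 0 0 - X 0 0| <= e / 4 * (X 0 2 - Y 0 2) ->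
  `|Y 0 1 - X 0 1| <= e / 4 * (X 0 2 - Y 0 2) -> D (frame_point p Q Y).
Proof.
move=> oQ e0 H X Y DX Xh lt2 le2 d0 d1.
set s := X 0 2 - Y 0 2 in le2 d0 d1 *.
have s0 : 0 < s by rewrite subr_gt0.
pose W : E3 := s^-1 *: (X - Y).
have XW : Y = X - s *: W.
  by rewrite /W scalerA divff ?gt_eqF// scale1r opprB addrCA subrr addr0.
have -> : frame_point p Q Y = frame_point p Q X - s *: (W *m Q).
  by rewrite {1}XW /frame_point mulmxBl scalemxAl addrA.
have Wb : `|W - mk3 0 0 1| <= e / 4.
  apply: norm3_le; rewrite coordB coordZ coordB !mk3E.
  - by rewrite subr0 normrM gtr0_norm ?invr_gt0// mulrC ler_pdivrMr// distrC.
  - by rewrite subr0 normrM gtr0_norm ?invr_gt0// mulrC ler_pdivrMr// distrC.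
  - by rewrite mulVf ?gt_eqF// subrr normr0 divr_ge0// ltW.
apply: H => //.
- by have := frame_lip p X 0 oQ; rewrite frame0 subr0; lra.
- have := norm_mul_orthogonal (W - mk3 0 0 1) oQ.
  by rewrite mulmxBl mk3_mul !scale0r !add0r scale1r; lra.
- by rewrite s0/=; lra.
Qed.

Lemma closure_frame D p Q X : orthogonal Q ->
  closure (frame_point p Q @^-1` D) X <-> closure D (frame_point p Q X).
Proof.
move=> oQ; split=> /closure_normP cX; apply/closure_normP => d d0.
  have [|Y DY YX] := cX (d / 3); first lra.
  by exists (frame_point p Q Y) => //; have := frame_lip p Y X oQ; lra.
have [|y Dy yX] := cX (d / 3); first lra.
exists (loc p Q y); first by rewrite /= frame_loc.
by have := loc_lip p y (frame_point p Q X) oQ; rewrite loc_frame//; lra.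
Qed.

(** The boundary of an open set is its closure minus the set, so the descriptions of [D] by [<] and
    of its closure by [<=] yield all three traces. *)
Lemma cone_hypograph D p Q : open D -> boundary D p -> orthogonal Q ->
  cone_dir D p (row 2 Q) -> exists r h zeta, hypograph_in_box D p Q r h zeta.
Proof.
move=> oD bDp oQ [e e0 H].
have [cDp nDp] := (boundary_open p oD).1 bDp.
have e40 : 0 < e / 4 by lra.
have oP : open (frame_point p Q @^-1` D).
  apply/open_normP => X /= /((open_normP D).1 oD)[d d0 dP].
  exists (d / 3) => [|Y YX]; first lra.
  by apply: dP; have := frame_lip p Y X oQ; lra.
have [||r [h [zeta [[r0 h0] zL z0 zh HP]]]] :=
  cone_graph e40 e40 (cone_frame_step oQ e0 H) oP.
- by apply/closure_frame => //; rewrite frame0.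
- by rewrite /= frame0.
have HX X : coord_box r h X ->
    (D (frame_point p Q X) <-> X 0 2 < zeta (X 0 0, X 0 1)) /\
    (closure D (frame_point p Q X) <-> X 0 2 <= zeta (X 0 0, X 0 1)).
  move=> /HP[XD Xc]; split; first exact: XD.
  exact: iff_trans (iff_sym (closure_frame D p X oQ)) Xc.
exists r, h, zeta; split => //; split; apply/box_traceP => X /HX[XD Xc].
- exact: XD.
- split => [/(boundary_open _ oD)[/Xc Xz nX]|XE].
    apply/eqP; rewrite eq_le Xz leNgt; apply/negP => lt.
    by apply: nX; exact/XD.
  apply/(boundary_open _ oD); split; first by apply/Xc; rewrite -XE.
  by move=> /XD; rewrite -XE ltxx.
- split => [nX|Xz].
    by rewrite /= ltNge; apply/negP => /Xc.
  by move=> /Xc; rewrite leNgt Xz.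
Qed.

Lemma lipschitz_domain_cone D : lipschitz_domain D ->
  forall p, boundary D p -> exists u, cone_dir D p u.
Proof.
move=> [_ _ _ _ H] p /H[u [_ [Q [r [h [z [_ /hypograph_cone cQ]]]]]]].
by exists (row 2 Q).
Qed.

Lemma cone_lipschitz_domain D : D !=set0 -> D <> setT -> open D ->
  compact (boundary D) ->
  (forall p, boundary D p -> exists u, cone_dir D p u) -> lipschitz_domain D.
Proof.
move=> D0 DT oD cD H; split => // p bp; have [u cu] := H p bp.
have u0 := cone_dir_neq0 bp oD cu.
(* The Euclidean norm of [u], not the sup norm, since frames are orthogonal. *)
pose c := Num.sqrt (\sum_i u 0 i ^+ 2).
have S0 : 0 < \sum_i u 0 i ^+ 2.
  rewrite lt0r sumr_ge0 ?andbT => [|i _]; last exact: sqr_ge0.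
  apply: contra u0; rewrite psumr_eq0 => [/allP Hi|i _]; last exact: sqr_ge0.
  apply/eqP/rowP => i; rewrite mxE; apply/eqP.
  by have := Hi i; rewrite mem_index_enum /= sqrf_eq0 => /(_ isT).
have c0 : 0 < c by rewrite sqrtr_gt0.
exists (c^-1 *: u); have uu : unit_vector (c^-1 *: u).
  rewrite /unit_vector; under eq_bigr do rewrite mxE exprMn.
  by rewrite -mulr_sumr exprVn sqr_sqrtr ?(ltW S0)// mulVf// gt_eqF.
split => //; have [Q oQ Qu] := unit_frame uu.
have [|r [h [z hz]]] := @cone_hypograph D p Q oD bp oQ.
  by rewrite Qu; apply: cone_dirZ => //; rewrite invr_gt0.
by exists Q, r, h, z.
Qed.

End ConeHypograph.

(** * Extension across a wall *)

Section Uniform.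
Context {R : realType} {V : normedModType R}.

(** Turns radii that are locally uniform near each point of a compact set into a single one. *)
Lemma compact_uniform_radius (K : set V) (P : R -> V -> Prop) : compact K ->
  (forall p, K p -> exists2 e, 0 < e &
     forall z d, `|z - p| < e -> 0 < d < e -> P d z) ->
  exists2 d, 0 < d & forall z, K z -> P d z.
Proof.
move=> /compact_near_coveringP cK H.
have : \forall d \near 0^'+, K `<=` P d.
  apply: cK => p /H[e e0 eP].
  exists ([set z | `|z - p| < e], [set d | 0 < d < e]).
    split; first by apply/near_normP; exists e.
    by near=> d; apply/andP; split; near: d; [exact: nbhs_right_gt|exact: nbhs_right_lt].
  by move=> [z d] [/= zp de]; exact: eP.
move=> KP; near (0 : R)^'+ => d; exists d => //.
by near: d.
Unshelve. all: by end_near. Qed.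

End Uniform.

Section Wall.
Context {R : realType}.
Local Notation E3 := 'rV[R]_3.
Implicit Types (D W : set E3) (p q u : E3).

(** Closeness to a compact set bounds the boundary even when [D] itself is unbounded. *)
Lemma near_compact_boundary (K D : set E3) (e : R) : compact K -> open D ->
  (forall q, boundary D q -> exists2 z, K z & `|z - q| <= e) ->
  compact (boundary D).
Proof.
move=> cK oD H; apply: bounded_closed_compact; last first.
  rewrite /boundary ((interior_id D).1 oD) setDE.
  by apply: closedI; [exact: closed_closure|exact: open_closedC].
have [M [_ MP]] := compact_bounded cK.
exists (M + 1 + e); split; first exact: num_real.
move=> N MN q /H[z Kz zq].
have := MP (M + 1) _ z Kz; rewrite ltrDl ltr01 => /(_ isT).
by rewrite /=; have := ler_distD z q 0; rewrite !subr0 (distrC q z); lra.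
Qed.

Lemma wall_extension (Omega Gamma Pi Gamma2 W : set E3) :
  lipschitz_domain Omega -> open W ->
  boundary Omega = Gamma `|` Pi `|` Gamma2 ->
  Gamma `<=` W -> (forall p, Pi p -> ~ W p) ->
  (forall p, Gamma2 p -> ~ closure W p) ->
  Pi `<=` closure Gamma -> Gamma !=set0 -> Gamma2 !=set0 ->
  (forall p, boundary Omega p -> exists u u',
     [/\ cone_dir W p u, cone_dir Omega p u,
         cone_dir W p u' & cone_dir Omega p (- u')]) ->
  exists Omegae : set E3,
    [/\ lipschitz_domain Omegae,
        Omega `&` Omegae = set0,
        boundary Omega `&` boundary Omegae = Gamma `|` Pi &
        lipschitz_domain (Omega `|` Gamma `|` Omegae)].
Proof.
move=> lO oW bOmega GW PW G2W PG [g0 Gg0] [g2 Gg2] cones.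
have [neO OT oO cO _] := lO.
have bOP p : boundary Omega p <-> closure Omega p /\ ~ Omega p by exact: boundary_open.
(* The vector [u] is common to the wall and [Omega]; [u'] is common to the wall and the exterior of
   [Omega]. *)
pose P (e : R) z := exists u u', [/\ cone_at W z u e, cone_at Omega z u e,
  cone_at W z u' e & cone_at Omega z (- u') e].
have [d d0 dP] : exists2 d, 0 < d & forall z, boundary Omega z -> P d z.
  apply: compact_uniform_radius => // p /cones[u [u' [[a a0 Ha] [b b0 Hb] [c c0 Hc] [d d0 Hd]]]].
  pose e := Num.min (Num.min a b) (Num.min c d).
  have e0 : 0 < e by rewrite !lt_min a0 b0 c0.
  have [[ea eb] [ec ed]] : (e <= a /\ e <= b) /\ (e <= c /\ e <= d).
    by rewrite !ge_min !lexx !orbT.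
  exists (e / 2) => [|z k zp /andP[k0 /ltW ke]]; first lra.
  have H D w : cone_at D p w e -> cone_at D z w k.
    move=> H; apply: (cone_at_le ke); apply: (cone_at_shift (ltW zp) _ H).
    by rewrite subrr normr0; lra.
  by exists u, u'; split; apply: H; [exact: cone_at_le Ha|exact: cone_at_le Hb|
    exact: cone_at_le Hc|exact: cone_at_le Hd].
have Pnear q : (exists2 z, boundary Omega z & `|z - q| <= d / 2) -> P (d / 2) q.
  move=> [z /dP[u [u' [Ha Hb Hc Hd]]] zq]; rewrite distrC in zq.
  have d20 : 0 <= d / 2 by lra.
  exists u, u'; split.
  - by apply: (cone_at_shift zq _ Ha); rewrite subrr normr0.
  - by apply: (cone_at_shift zq _ Hb); rewrite subrr normr0.
  - by apply: (cone_at_shift zq _ Hc); rewrite subrr normr0.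
  - by apply: (cone_at_shift zq _ Hd); rewrite subrr normr0.
(* A point of [closure F] is less than [d / 2] from [Omega]; if it is outside [Omega], the boundary
   is within [d / 2] and [Pnear] applies to it. *)
pose F := fatten Omega (d / 4).
have oF : open F by exact: open_fatten.
have clF : closure Omega `<=` F.
  move=> x /closure_normP /(_ (d / 4)) [|y Oy yx]; first lra.
  by exists y => //; rewrite distrC.
have OF : Omega `<=` F by move=> x /subset_closure/clF.
have nearF q : closure F q -> ~ Omega q -> exists2 z, boundary Omega z & `|z - q| <= d / 2.
  move=> /closure_normP /(_ (d / 4)) [|x [y Oy xy] xq nq]; first lra.
  have [z bz zq] := segment_boundary oO Oy nq.
  by exists z => //; have := ler_distD x y q; rewrite (distrC y x); lra.
have coneF q u : cone_at Omega q u (d / 2) -> cone_dir F q u.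
  move=> H; exists (d / 2 / 2); first lra.
  by apply: cone_at_fatten H; lra.
have dir D q u : cone_at D q u (d / 2) -> cone_dir D q u by exists (d / 2) => //; lra.
pose Oe := W `&` F `&` ~` closure Omega.
have oOe : open Oe.
  by apply: openI; [exact: openI|apply: closed_openC; exact: closed_closure].
have dOe : Omega `&` Oe = set0.
  by apply/seteqP; split=> x // [inx [_]]; apply; exact: subset_closure.
have nOe q : closure Oe q -> ~ Omega q.
  move=> cq Oq; have /cq[x [[_ nx] inx]] : nbhs q Omega by rewrite -(interior_id Omega).1 in Oq.
  by apply: nx; exact: subset_closure.
have clOeF : closure Oe `<=` closure F by apply: closureS => x [[]].
(* The open set [W] contains [Gamma] and no other point of the boundary of [Omega], so adding
   [Gamma] and [Oe] amounts to adding [W] and [F] intersected. *)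
have OtE : Omega `|` Gamma `|` Oe = Omega `|` (W `&` F).
  apply/seteqP; split=> x.
    move=> [[inx|Gx]|[[Wx Fx] _]]; [by left| |by right].
    right; split; first exact: GW.
    by apply: clF; have /bOP[] : boundary Omega x by rewrite bOmega; left; left.
  move=> [inx|[Wx Fx]]; first by left; left.
  have [inx|nOx] := pselect (Omega x); first by left; left.
  have [cx|ncx] := pselect (closure Omega x); last by right.
  have : boundary Omega x by apply/bOP.
  rewrite bOmega => -[[Gx|Px]|G2x]; first by left; right.
    by have := PW _ Px.
  by have := G2W _ G2x; move/(_ (subset_closure Wx)).
(* A short step from a point of [Gamma] along [+ u] leaves [closure Omega] but stays in the open
   sets [W] and [F]. *)
have GOe : Gamma `<=` closure Oe.
  move=> p Gp; apply/closure_normP => e e0.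
  have bp : boundary Omega p by rewrite bOmega; left; left.
  have [cp nOp] := (bOP p).1 bp.
  have [u [_ [_ Ou _ _]]] := cones p bp.
  have [a a0 aP] := cone_dir_notin_closure nOp Ou.
  have [b b0 bP] := (open_normP (W `&` F)).1 (openI oW oF) p (conj (GW _ Gp) (clF _ cp)).
  have m0 : 0 < Num.min b e by rewrite lt_min b0.
  have [k /andP[k0 _] kP] := small_step u m0.
  have [s [s0 sa sk]] : exists s, [/\ 0 < s, s < a & s < k].
    exists (Num.min a k / 2); split.
    - by rewrite divr_gt0// lt_min a0.
    - by rewrite ltr_pdivrMr// gt_min; apply/orP; left; lra.
    - by rewrite ltr_pdivrMr// gt_min; apply/orP; right; lra.
  have : `|p + s *: u - p| < Num.min b e.
    by rewrite addrAC subrr add0r; apply: kP; rewrite ?subrr ?normr0// s0.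
  rewrite lt_min => /andP[pb pe].
  exists (p + s *: u) => //; split; first exact: bP.
  by apply: aP; rewrite s0.
exists Oe; split => //.
- apply: cone_lipschitz_domain => //.
  + by have /closure_normP/(_ 1 ltr01)[x] := GOe _ Gg0; exists x.
  + move=> OeT; case: neO => x inx.
    by have : (Omega `&` Oe) x; [rewrite OeT|rewrite dOe].
  + apply: (near_compact_boundary (e := d / 2) cO oOe) => q /(boundary_open _ oOe)[cq _].
    by apply: nearF; [exact: clOeF|exact: nOe].
  + move=> q /(boundary_open _ oOe)[cq _].
    have nq := nOe _ cq.
    have [u [u' [Wu Ou Wu' Ou']]] := Pnear _ (nearF _ (clOeF _ cq) nq).
    (* On the boundary of [Omega] the set [F] is a full neighborhood, and [u'] suits the wall and
       the exterior. Off the closure the exterior is a full neighborhood, and [u] suits the wall and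
       [F]. *)
    have [cOq|ncOq] := pselect (closure Omega q).
      exists u'; apply: cone_dirI.
        apply: cone_dirI; first exact: dir.
        have [e e0 eP] := (open_normP F).1 oF _ (clF _ cOq).
        exact: cone_dir_full eP.
      by rewrite -[u']opprK; apply: cone_dir_setC_closure; exact: dir.
    exists u; apply: cone_dirI.
      by apply: cone_dirI; [exact: dir|exact: coneF].
    have oC : open (~` closure Omega) by apply: closed_openC; exact: closed_closure.
    have [e e0 eP] := (open_normP _).1 oC _ ncOq.
    exact: cone_dir_full eP.
- apply/seteqP; split=> p.
    rewrite {1}bOmega => -[[//|G2p] [cp _]].
    by have := G2W _ G2p; case; apply: closureS cp => x [[]].
  move=> GPp; split; first by rewrite bOmega; left.
  have : boundary Omega p by rewrite bOmega; left.
  move=> /bOP[cp _]; apply/(boundary_open _ oOe); split; last by move=> [_].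
  case: GPp => [Gp|/PG]; first exact: GOe.
  by move=> /(closureS GOe); rewrite -((closure_id _).1 (@closed_closure _ Oe)).
- rewrite OtE.
  have oOt : open (Omega `|` (W `&` F)) by apply: openU => //; exact: openI.
  have nearOt q : boundary (Omega `|` (W `&` F)) q -> exists2 z, boundary Omega z & `|z - q| <= d / 2.
    move=> /(boundary_open _ oOt)[cq nq].
    apply: nearF; last by move=> Oq; apply: nq; left.
    by apply: closureS cq => x [/OF|[]].
  apply: cone_lipschitz_domain => //.
  + by case: neO => x; exists x; left.
  + move=> OtT; have : (Omega `|` (W `&` F)) g2 by rewrite OtT.
    have /bOP[_ nOg] : boundary Omega g2 by rewrite bOmega; right.
    by move=> [//|[Wg _]]; apply: (G2W _ Gg2); exact: subset_closure.
  + exact: near_compact_boundary nearOt.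
  + move=> q /nearOt/Pnear[u [u' [Wu Ou _ _]]]; exists u.
    apply: cone_dirU; first exact: dir.
    by apply: cone_dirI; [exact: dir|exact: coneF].
Qed.

End Wall.

(** * Strict differentials *)

Section StrictDerivative.
Context {R : realType}.
Local Notation E3 := 'rV[R]_3.
Implicit Types (x y z p u v w t : E3) (N : 'cV[R]_3) (g f : E3 -> R) (S : set E3).

Definition linform N z : R := (z *m N) 0 0.

Lemma linformD N z w : linform N (z + w) = linform N z + linform N w.
Proof. by rewrite /linform mulmxDl mxE. Qed.

Lemma linformB N z w : linform N (z - w) = linform N z - linform N w.
Proof. by rewrite /linform mulmxBl !mxE. Qed.

Lemma linformZ N (a : R) z : linform N (a *: z) = a * linform N z.
Proof. by rewrite /linform -scalemxAl mxE. Qed.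

Lemma linformN N z : linform N (- z) = - linform N z.
Proof. by rewrite /linform mulNmx mxE. Qed.

Lemma linform0 z : linform 0 z = 0.
Proof. by rewrite /linform mulmx0 mxE. Qed.

Lemma linformZl (a : R) N z : linform (a *: N) z = a * linform N z.
Proof. by rewrite /linform -scalemxAr mxE. Qed.

Lemma linformDl N N' z : linform (N + N') z = linform N z + linform N' z.
Proof. by rewrite /linform mulmxDr mxE. Qed.

Lemma linform_sum (I : Type) (r : seq I) (F : I -> 'cV[R]_3) z :
  linform (\sum_(i <- r) F i) z = \sum_(i <- r) linform (F i) z.
Proof.
elim: r => [|i r IH]; first by rewrite !big_nil linform0.
by rewrite !big_cons linformDl IH.
Qed.

Lemma linform_neq0 N : N != 0 -> exists z, linform N z != 0.
Proof.
apply: contraNP => H; apply/eqP/colP => i; rewrite mxE.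
apply: contrapT => /eqP Ni; apply: H; exists (delta_mx 0 i).
by rewrite /linform -rowE mxE.
Qed.

Lemma linform_bound N : exists2 C, 0 < C & forall z, `|linform N z| <= C * `|z|.
Proof.
exists (`|N 0 0| + `|N 1 0| + `|N 2 0| + 1) => [|z].
  by have := normr_ge0 (N 0 0); have := normr_ge0 (N 1 0); have := normr_ge0 (N 2 0); lra.
rewrite /linform mxE sum3E.
have B i : `|z 0 i * N i 0| <= `|z| * `|N i 0|.
  by rewrite normrM ler_wpM2r// coord_le_norm.
have := ler_normD (z 0 0 * N 0 0 + z 0 1 * N 1 0) (z 0 2 * N 2 0).
have := ler_normD (z 0 0 * N 0 0) (z 0 1 * N 1 0).
by have := normr_ge0 z; move: (B 0) (B 1) (B 2); lra.
Qed.

Definition lipschitz_fun g := exists2 M : R, 0 < M & forall x y, `|g x - g y| <= M * `|x - y|.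

(** Differentiability with both points free: cone conditions at [p] involve steps that start at any
    point near [p]. *)
Definition strict_diff g p N := forall e : R, 0 < e -> exists2 d : R, 0 < d &
  forall x y, `|x - p| < d -> `|y - p| < d ->
    `|g x - g y - linform N (x - y)| <= e * `|x - y|.

(** All short secants of [S] near [p] are almost parallel to [t]. No parametrization enters, so the
    same [t] can be used in every chart around [p]. *)
Definition strict_tangent S p t := forall e : R, 0 < e -> exists2 d : R, 0 < d &
  forall x y, S x -> S y -> `|x - p| < d -> `|y - p| < d ->
    exists l : R, `|x - y - l *: t| <= e * `|x - y|.

Lemma strict_diff_locally0 g p (d : R) : 0 < d -> (forall x, `|x - p| < d -> g x = 0) ->
  strict_diff g p 0.
Proof.
move=> d0 H e e0; exists d => // x y xp yp.
by rewrite !H// linform0 !subr0 normr0 mulr_ge0// ltW.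
Qed.

Lemma strict_diffD f g p N N' : strict_diff f p N -> strict_diff g p N' ->
  strict_diff (fun x => f x + g x) p (N + N').
Proof.
move=> Hf Hg e e0; have e20 : 0 < e / 2 by lra.
have [d1 d10 H1] := Hf _ e20; have [d2 d20 H2] := Hg _ e20.
exists (Num.min d1 d2); first by rewrite lt_min d10.
move=> x y; rewrite !lt_min => /andP[x1 x2] /andP[y1 y2].
have := H1 _ _ x1 y1; have := H2 _ _ x2 y2.
rewrite linformDl.
have -> : f x + g x - (f y + g y) - (linform N (x - y) + linform N' (x - y)) =
  (f x - f y - linform N (x - y)) + (g x - g y - linform N' (x - y)) by ring.
have := ler_normD (f x - f y - linform N (x - y)) (g x - g y - linform N' (x - y)).
by lra.
Qed.

Lemma strict_diff_sum (I : eqType) (r : seq I) (F : I -> E3 -> R) (N : I -> 'cV[R]_3) p :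
  (forall i, i \in r -> strict_diff (F i) p (N i)) ->
  strict_diff (fun x => \sum_(i <- r) F i x) p (\sum_(i <- r) N i).
Proof.
elim: r => [|i r IH] H.
  rewrite big_nil; apply: (@strict_diff_locally0 _ _ 1) => // x _.
  by rewrite big_nil.
have Hr : forall j, j \in r -> strict_diff (F j) p (N j).
  by move=> j jr; apply: H; rewrite inE jr orbT.
move=> e e0; have [d d0 dP] := strict_diffD (H i (mem_head _ _)) (IH Hr) e0.
by exists d => // x y xp yp; rewrite !big_cons; exact: dP.
Qed.

(** Because [g] vanishes at [p], the factor [f] need only be Lipschitz. This permits cut-off
    functions with corners. *)
Lemma strict_diffM f g p N : lipschitz_fun f -> lipschitz_fun g -> g p = 0 ->
  strict_diff g p N -> strict_diff (fun x => f x * g x) p (f p *: N).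
Proof.
move=> [A A0 HA] [B B0 HB] gp Hg e e0.
have n0 := normr_ge0 (f p).
pose e1 := e / (2 * (`|f p| + 1)).
have e10 : 0 < e1 by rewrite divr_gt0// mulr_gt0//; lra.
have e1E : `|f p| * e1 <= e / 2.
  have : e1 * (2 * (`|f p| + 1)) = e by rewrite divfK// gt_eqF// mulr_gt0//; lra.
  by nra.
have [d d0 dP] := Hg _ e10.
pose d1 := e / (4 * (A * B)).
have d10 : 0 < d1 by rewrite divr_gt0// !mulr_gt0.
have d1E : A * B * d1 = e / 4.
  by rewrite /d1; field; rewrite !gt_eqF.
exists (Num.min d d1); first by rewrite lt_min d0.
move=> x y; rewrite !lt_min => /andP[x1 x2] /andP[y1 y2].
rewrite linformZl.
have -> : f x * g x - f y * g y - f p * linform N (x - y) =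
  f p * (g x - g y - linform N (x - y)) + (f x - f p) * (g x - g y) + (f x - f y) * g y by ring.
have h1 : `|f p * (g x - g y - linform N (x - y))| <= e / 2 * `|x - y|.
  rewrite normrM; apply: le_trans (_ : `|f p| * (e1 * `|x - y|) <= _).
    by rewrite ler_wpM2l// dP.
  by rewrite mulrA ler_wpM2r.
have nxy := normr_ge0 (x - y).
have h2 : `|(f x - f p) * (g x - g y)| <= e / 4 * `|x - y|.
  rewrite normrM -d1E.
  apply: le_trans (_ : (A * d1) * (B * `|x - y|) <= _); last by rewrite le_eqVlt; apply/orP; left; apply/eqP; ring.
  apply: ler_pM => //; apply: le_trans (HA _ _) _.
  by rewrite ler_pM2l// ltW.
have h3 : `|(f x - f y) * g y| <= e / 4 * `|x - y|.
  rewrite normrM -d1E.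
  apply: le_trans (_ : (A * `|x - y|) * (B * d1) <= _); last by rewrite le_eqVlt; apply/orP; left; apply/eqP; ring.
  apply: ler_pM => //; rewrite -[g y]subr0 -gp; apply: le_trans (HB _ _) _.
  by rewrite ler_pM2l// ltW.
have := ler_normD (f p * (g x - g y - linform N (x - y)) + (f x - f p) * (g x - g y)) ((f x - f y) * g y).
have := ler_normD (f p * (g x - g y - linform N (x - y))) ((f x - f p) * (g x - g y)).
by lra.
Qed.

Lemma strict_diff_cone g p N u : strict_diff g p N -> 0 < linform N u ->
  cone_dir [set x | g x < 0] p u.
Proof.
move=> Hg Nu; have [C C0 CP] := linform_bound N.
have n0 := normr_ge0 u.
pose e := linform N u / (4 * (`|u| + 1)).
have e0 : 0 < e by rewrite divr_gt0// mulr_gt0//; lra.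
have eE : e * (`|u| + 1) = linform N u / 4.
  by rewrite /e invfM mulrA divfK// gt_eqF//; lra.
have [d d0 dP] := Hg _ e0.
have d20 : 0 < d / 2 by lra.
have [k /andP[k0 kd] kP] := small_step u d20.
pose m := Num.min k (Num.min 1 (linform N u / (4 * C))).
have m0 : 0 < m by rewrite !lt_min k0 ltr01 divr_gt0// mulr_gt0.
have [mk m1 mC] : [/\ m <= k, m <= 1 & m <= linform N u / (4 * C)].
  by split; rewrite !ge_min !lexx ?orbT.
exists m => // x w s /= gx xp wu /andP[s0 sm].
have sw : `|s *: w| < d / 2 by apply: kP; [lra|rewrite s0/=; lra].
have xp' : `|x - p| < d by lra.
have xsp : `|x - s *: w - p| < d.
  by rewrite addrAC; have := ler_normB (x - p) (s *: w); lra.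
have := dP _ _ xsp xp'.
rewrite [x - _ - x]addrAC subrr add0r -scaleNr linformZ scaleNr normrN normrZ gtr0_norm//.
have wn : `|w| < `|u| + 1 by have := lerB_dist w u; lra.
have lw : linform N w >= linform N u / 2 + e * (`|u| + 1).
  have := CP (w - u); rewrite linformB ler_norml => /andP[+ _].
  move: mC; rewrite ler_pdivlMr ?mulr_gt0// => mC.
  have : C * `|w - u| <= C * m by rewrite ler_pM2l// ltW.
  by rewrite eE; lra.
rewrite ler_norml => /andP[_ H].
have : s * (linform N u / 2 + e * (`|u| + 1)) <= s * linform N w by rewrite ler_pM2l.
have : e * (s * `|w|) <= e * (s * (`|u| + 1)) by rewrite !ler_pM2l// ltW.
have : 0 < s * linform N u by rewrite mulr_gt0.
by lra.
Qed.

(** Were the value at [y] positive, a step along [z] near [y] from [p + s *: z] would return to [p]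
    and give [g p < 0]. *)
Lemma strict_diff_secant_le0 g p N y : strict_diff g p N -> g p = 0 ->
  (forall e : R, 0 < e -> exists (s : R) z,
     [/\ 0 < s < e, `|z - y| < e & g (p + s *: z) < 0]) -> linform N y <= 0.
Proof.
move=> Hg gp H; rewrite leNgt; apply/negP => Ny.
have [e0 e00 He] := strict_diff_cone Hg Ny.
have e20 : 0 < e0 / 2 by lra.
have [k /andP[k0 kd] kP] := small_step y e20.
have [s [z [/andP[s0 sk] zy gz]]] := H _ k0.
have sz : `|s *: z| < e0 / 2 by apply: kP; rewrite ?s0.
have := He (p + s *: z) z s gz.
rewrite addrAC subrr add0r addrK /= gp ltxx s0 /=.
move=> /(_ _ _ _)H'; suff: false by [].
by apply: H'; lra.
Qed.

End StrictDerivative.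

Section WeightedSum.
Context {R : realType}.

Lemma weighted_sum_lt0 (I : eqType) (r : seq I) (phi F : I -> R) :
  (forall i, 0 <= phi i) -> (forall i, i \in r -> 0 < phi i -> F i < 0) ->
  (exists2 i, i \in r & 0 < phi i) -> \sum_(i <- r) phi i * F i < 0.
Proof.
move=> phi0 HF [i0 i0r i0P]; rewrite (big_rem _ i0r) /=.
apply: ltr_wnDr; last by rewrite pmulr_rlt0// HF.
rewrite big_seq; apply: sumr_le0 => i /mem_rem ir.
have := phi0 i; rewrite le_eqVlt => /predU1P[<-|pi]; first by rewrite mul0r.
by rewrite pmulr_rle0// ltW// HF.
Qed.

Lemma weighted_sum_gt0 (I : eqType) (r : seq I) (phi F : I -> R) :
  (forall i, 0 <= phi i) -> (forall i, i \in r -> 0 < phi i -> 0 < F i) ->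
  (exists2 i, i \in r & 0 < phi i) -> 0 < \sum_(i <- r) phi i * F i.
Proof.
move=> phi0 HF Hi; rewrite -oppr_lt0 -sumrN.
under eq_bigr do rewrite -mulrN.
by apply: weighted_sum_lt0 => // i ir pi; rewrite oppr_lt0 HF.
Qed.

Lemma weighted_sum_eq0 (I : eqType) (r : seq I) (phi F : I -> R) :
  (forall i, 0 <= phi i) -> (forall i, i \in r -> 0 < phi i -> F i = 0) ->
  \sum_(i <- r) phi i * F i = 0.
Proof.
move=> phi0 HF; rewrite big_seq big1// => i ir.
have := phi0 i; rewrite le_eqVlt => /predU1P[<-|pi]; first by rewrite mul0r.
by rewrite HF// mulr0.
Qed.

End WeightedSum.

(** * Sign changes of a sum of linear forms on a convex cone *)

Section ConvexCone.
Context {R : realType}.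
Local Notation E3 := 'rV[R]_3.
Variables (C : set E3) (t y v0 : E3).
Hypothesis Copen : forall u, C u -> exists2 e, 0 < e & forall w, `|w - u| < e -> C w.
Hypothesis CD : forall u w, C u -> C w -> C (u + w).
Hypothesis CZ : forall (c : R) u, 0 < c -> C u -> C (c *: u).
Hypothesis Cv0 : C v0.
Hypothesis Cty : forall a b : R, ~ C (a *: t + b *: y).
Hypothesis span : forall z, exists a b c : R, z = a *: v0 + b *: y + c *: t.

(** Write [v i] in terms of [v0], [y] and [t]. For a form [K] killing [t], the product of
    [linform (N i) y] and [linform K (v i)] is a positive multiple of a 2 by 2 determinant of [N i]
    and [K] at [y] and [v0]. For [K = M], the weighted sum of the forms, these determinants weighted
    by [phi i] add up to the determinant of [M] with itself, which is 0. So the values of [M] at the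
    active [v i] are neither all positive nor all negative. *)
Lemma cone_both_signs (I : eqType) (r : seq I) (phi : I -> R)
    (N : I -> 'cV[R]_3) (v : I -> E3) :
  (forall i, 0 <= phi i) ->
  (forall i, i \in r -> 0 < phi i -> [/\ C (v i), linform (N i) (v i) = 0,
     linform (N i) t = 0, linform (N i) y <= 0 & N i != 0]) ->
  (exists2 i, i \in r & 0 < phi i) ->
  exists u u', [/\ C u, 0 < linform (\sum_(i <- r) phi i *: N i) u,
                   C u' & linform (\sum_(i <- r) phi i *: N i) u' < 0].
Proof.
move=> phi0 H [i0 i0r i0P].
set M := \sum_(i <- r) _.
have ME z : linform M z = \sum_(i <- r) phi i * linform (N i) z.
  by rewrite /M linform_sum; apply: eq_bigr => i _; rewrite linformZl.
have neg (F : I -> R) : (forall i, i \in r -> 0 < phi i -> F i < 0) ->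
    \sum_(i <- r) phi i * F i < 0.
  by move=> HF; apply: weighted_sum_lt0 => //; exists i0.
have P i : i \in r -> 0 < phi i -> linform (N i) y < 0 /\ exists2 a, 0 < a &
    forall K, linform K t = 0 -> (linform (N i) y) * linform K (v i) = a * (linform (N i) y * linform K v0 - linform (N i) v0 * linform K y).
  move=> ir pi; have [Cv Nv Nt Ny N0] := H _ ir pi.
  have [a [b [c E]]] := span (v i).
  (* If [a <= 0], adding [(- a) *: v0] to [v i] would stay in the convex cone and land in the plane
     spanned by [t] and [y]. *)
  have a0 : 0 < a.
    rewrite ltNge; apply/negP => a0; apply: (@Cty c b).
    have -> : c *: t + b *: y = v i + (- a) *: v0.
      by rewrite E scaleNr [RHS]addrAC (addrC (a *: v0)) addrK addrC.
    move: a0; rewrite le_eqVlt => /predU1P[->|a0]; first by rewrite oppr0 scale0r addr0.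
    by apply: CD => //; apply: CZ => //; rewrite oppr_gt0.
  have EK K : linform K t = 0 -> linform K (v i) = a * linform K v0 + b * linform K y.
    by move=> Kt; rewrite E !linformD !linformZ Kt mulr0 addr0.
  have NE := EK _ Nt; rewrite Nv in NE.
  split.
    rewrite lt_neqAle Ny andbT; apply/eqP => y0.
    have z0 : linform (N i) v0 = 0.
      by apply/eqP; move/esym/eqP: NE; rewrite y0 mulr0 addr0 mulf_eq0 (gt_eqF a0).
    have [z] := linform_neq0 N0; have [a' [b' [c' ->]]] := span z.
    by rewrite !linformD !linformZ Nt y0 z0 !mulr0 !addr0 eqxx.
  exists a => // K Kt; rewrite (EK _ Kt) mulrDr mulrBr.
  have -> : a * (linform (N i) v0 * linform K y) = (- (b * linform (N i) y)) * linform K y.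
    by rewrite mulrA; congr (_ * _); apply/eqP; rewrite -addr_eq0 -NE.
  by ring.
have Mt : linform M t = 0.
  rewrite ME big_seq big1// => i ir.
  have := phi0 i; rewrite le_eqVlt => /predU1P[<-|pi]; first by rewrite mul0r.
  by have [_ _ -> _ _] := H _ ir pi; rewrite mulr0.
have My : linform M y < 0.
  by rewrite ME; apply: neg => i ir pi; have [] := P _ ir pi.
have S0 (s : R) : \sum_(i <- r) phi i * (s * (linform (N i) y * linform M v0 - linform (N i) v0 * linform M y)) = 0.
  under eq_bigr do rewrite mulrCA mulrBr !mulrA.
  by rewrite -mulr_sumr big_split/= sumrN -!mulr_suml -!ME [linform M v0 * _]mulrC subrr mulr0.
have ny0 : 0 < `|y| + 1 by have := normr_ge0 y; lra.
(* As [linform M y < 0], a small displacement along [y], allowed by the openness of the cone, makes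
   the weak inequalities at [v i] and [v j] strict. *)
have push (u : E3) : C u -> exists2 d : R, 0 < d & C (u - d *: y) /\ C (u + d *: y).
  move=> /Copen[e e0 eP]; exists (e / (2 * (`|y| + 1))); first by rewrite divr_gt0// mulr_gt0.
  have B : `|(e / (2 * (`|y| + 1))) *: y| < e.
    rewrite normrZ gtr0_norm ?divr_gt0 ?mulr_gt0// mulrAC ltr_pdivrMr ?mulr_gt0//.
    by rewrite ltr_pM2l//; have := normr_ge0 y; lra.
  by split; apply: eP; rewrite addrAC subrr add0r ?normrN.
have pos_i : exists2 i, i \in r & 0 < phi i /\ 0 <= linform M (v i).
  apply: contrapT => nex.
  suff : \sum_(i <- r) phi i * (-1 * (linform (N i) y * linform M v0 - linform (N i) v0 * linform M y)) < 0.
    by rewrite S0 ltxx.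
  apply: neg => i ir pi; have [ny [a a0 aP]] := P _ ir pi.
  rewrite mulN1r oppr_lt0 -(pmulr_rgt0 _ a0) -aP// nmulr_rgt0//.
  by rewrite ltNge; apply/negP => Mv; apply: nex; exists i.
have neg_i : exists2 i, i \in r & 0 < phi i /\ linform M (v i) <= 0.
  apply: contrapT => nex.
  suff : \sum_(i <- r) phi i * (1 * (linform (N i) y * linform M v0 - linform (N i) v0 * linform M y)) < 0.
    by rewrite S0 ltxx.
  apply: neg => i ir pi; have [ny [a a0 aP]] := P _ ir pi.
  rewrite mul1r -(pmulr_rlt0 _ a0) -aP// nmulr_rlt0//.
  by rewrite ltNge; apply/negP => Mv; apply: nex; exists i.
have [i ir [pi Mi]] := pos_i; have [j jr [pj Mj]] := neg_i.
have [Ci _ _ _ _] := H _ ir pi; have [Cj _ _ _ _] := H _ jr pj.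
have [d d0 [Cd _]] := push _ Ci; have [d' d'0 [_ Cd']] := push _ Cj.
exists (v i - d *: y), (v j + d' *: y); split => //.
  by rewrite linformB linformZ subr_gt0; apply: lt_le_trans Mi; rewrite pmulr_rlt0.
by rewrite linformD linformZ; apply: ltr_wnDl => //; rewrite pmulr_rlt0.
Qed.

End ConvexCone.

Section StrictC1.
Context {R : realType}.
Local Notation E3 := 'rV[R]_3.

(** The mean value theorem in each coordinate, with its own intermediate point, suffices for the sup
    norm; continuity of the derivative at [t] controls these points. *)
Lemma C1_strict (f : R -> E3) (t d0 : R) : 0 < d0 ->
  (forall s, `|s - t| < d0 -> derivable f s 1) ->
  {for t, continuous (derive1 f)} ->
  forall e : R, 0 < e -> exists2 d : R, 0 < d & forall s s', `|s - t| < d ->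
    `|s' - t| < d -> `|f s - f s' - (s - s') *: derive1 f t| <= e * `|s - s'|.
Proof.
move=> d00 df cf e e0.
have [d1 d10 H1] : exists2 d, 0 < d & forall s, `|s - t| < d ->
    `|derive1 f s - derive1 f t| <= e.
  have /cvgrPdist_le/(_ e e0)/near_normP[d d0' H] := cf.
  exists d; first exact: d0'.
  move=> s st.
  by rewrite -normrN opprB; exact: H.
exists (Num.min d0 d1); first by rewrite lt_min d00.
have main s s' : s' < s -> `|s - t| < Num.min d0 d1 -> `|s' - t| < Num.min d0 d1 ->
    `|f s - f s' - (s - s') *: derive1 f t| <= e * `|s - s'|.
  move=> lt; rewrite !lt_min => /andP[s1 s2] /andP[s'1 s'2].
  have btw (c b : R) : c \in `[s', s] -> `|s - t| < b -> `|s' - t| < b -> `|c - t| < b.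
    by rewrite in_itv /= => /andP[c1 c2]; rewrite !ltr_norml; lra.
  suff H i : `|(f s - f s' - (s - s') *: derive1 f t) 0 i| <= e * `|s - s'|.
    exact: norm3_le.
  pose fi (c : R) : R := f c 0 i.
  have dfi c : c \in `[s', s] -> derivable fi c 1.
    by move=> cs; have /derivable_mxP/(_ 0 i) := df c (btw _ _ cs s1 s'1).
  have [c cs E] : exists2 c, c \in `]s', s[ & fi s - fi s' = (derive1 f c) 0 i * (s - s').
    apply: MVT => //.
      move=> c cs; have cs' : c \in `[s', s] by apply: subset_itv_oo_cc cs.
      split; first exact: dfi.
      have dfc := df c (btw _ _ cs' s1 s'1).
      have -> : derive1 f c = 'D_1 f c by rewrite derive1E.
      by rewrite (derive_mx dfc) mxE.
    by apply: derivable_within_continuous => c /dfi.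
  have cs' : c \in `[s', s] by apply: subset_itv_oo_cc cs.
  rewrite stepE coordB -/(fi s) -/(fi s') E [derive1 f c 0 i * _]mulrC -mulrBr normrM mulrC.
  rewrite ler_wpM2r// -coordB; apply: le_trans (coord_le_norm _ _) _.
  by apply: H1; exact: (btw _ _ cs' s2 s'2).
move=> s s' sd s'd; have [lt|lt|->] := ltgtP s s'; last first.
- by rewrite !subrr scale0r subrr !normr0 mulr0.
- exact: main.
- have := main _ _ lt s'd sd; rewrite (distrC s'); apply: le_trans.
  by rewrite -[leLHS]normrN opprB -(opprB s' s) scaleNr opprB addrC.
Qed.

End StrictC1.

(** * A chart of the dissection *)

Section Secants.
Context {R : realType} {V : normedModType R}.

Lemma finite_gap (F : set R) (a : R) : finite_set F ->
  exists2 d, 0 < d & forall s, F s -> s <> a -> d <= `|s - a|.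
Proof.
move=> finF.
have cF : closed (F `\ a).
  apply: accessible_finite_set_closed.1; last exact: finite_setD.
  by apply: hausdorff_accessible; exact: Rhausdorff.
have oF : open (~` (F `\ a)) by exact: closed_openC.
have [|d d0 dP] := (open_normP (~` (F `\ a))).1 oF a; first by move=> [_ /(_ erefl)].
exists d => // s Fs sa; rewrite leNgt; apply/negP => /dP; apply.
by split.
Qed.

(** A step from [x] along the secant [t^-1 *: (x - x')], close to [z], ends at the boundary point
    [x'], which is not in the open set [D]. *)
Lemma secant_not_cone (D : set V) (p z : V) : open D ->
  (forall e : R, 0 < e -> exists x x' (t : R), [/\ boundary D x, boundary D x',
     `|x - p| < e, 0 < t < e & `|x - x' - t *: z| <= e * t]) ->
  ~ cone_dir D p z.
Proof.
move=> oD H [e e0 eP].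
have e20 : 0 < e / 2 by lra.
have [x [x' [t [bx bx' xp /andP[t0 te] xz]]]] := H _ e20.
have [_ nx'] := (boundary_open x' oD).1 bx'; apply: nx'.
have -> : x' = x - t *: (t^-1 *: (x - x')).
  by rewrite scalerA divff ?gt_eqF// scale1r opprB addrCA subrr addr0.
apply: (cone_at_closure eP).
- by have [] := (boundary_open x oD).1 bx.
- lra.
- have -> : t^-1 *: (x - x') - z = t^-1 *: (x - x' - t *: z).
    by rewrite [RHS]scalerBr scalerA mulVf ?gt_eqF// scale1r.
  rewrite normrZ gtr0_norm ?invr_gt0// mulrC ltr_pdivrMr//.
  apply: le_lt_trans xz _; rewrite ltr_pM2r//; lra.
- by rewrite t0/=; lra.
Qed.

End Secants.

Section Chart.
Context {R : realType}.
Local Notation E3 := 'rV[R]_3.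
Implicit Types (x y z u v w t : E3).
Variables (Gamma Pi Gamma2 : set E3) (p : E3) (Q : 'M[R]_3) (r h L : R).
Variables (zeta : R * R -> R) (rho : R -> R).
Hypotheses (oQ : orthogonal Q) (r0 : 0 < r) (h0 : 0 < h) (L0 : 0 < L).
Hypothesis zetaL : forall a b a' b', `|a| <= r -> `|b| <= r -> `|a'| <= r ->
  `|b'| <= r -> `|zeta (a, b) - zeta (a', b')| <= L * (`|a - a'| + `|b - b'|).
Hypothesis rhoL : forall a a', `|a| <= r -> `|a'| <= r ->
  `|rho a - rho a'| <= L * `|a - a'|.
Hypothesis zetah : forall a b, `|a| < r -> `|b| < r -> `|zeta (a, b)| < h.
Hypothesis GammaP : forall X, coord_box r h X ->
  Gamma (frame_point p Q X) <-> X 0 2 = zeta (X 0 0, X 0 1) /\ X 0 1 < rho (X 0 0).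
Hypothesis PiP : forall X, coord_box r h X ->
  Pi (frame_point p Q X) <-> X 0 2 = zeta (X 0 0, X 0 1) /\ X 0 1 = rho (X 0 0).
Hypothesis Gamma2P : forall X, coord_box r h X ->
  Gamma2 (frame_point p Q X) <-> X 0 2 = zeta (X 0 0, X 0 1) /\ X 0 1 > rho (X 0 0).
Hypothesis Pip : Pi p.

Definition curve s := frame_point p Q (dissection_curve rho zeta s).

Lemma coord_box0 : coord_box r h 0.
Proof. by apply/coord_boxP; rewrite !mxE normr0. Qed.

Lemma rho0 : rho 0 = 0.
Proof.
have := (PiP coord_box0).1; rewrite frame0 !mxE => /(_ Pip)[_].
by [].
Qed.

Lemma zeta0 : zeta (0, 0) = 0.
Proof.
by have := (PiP coord_box0).1; rewrite frame0 !mxE => /(_ Pip)[<-].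
Qed.

Lemma curve_loc s : loc p Q (curve s) = mk3 s (rho s) (zeta (s, rho s)).
Proof. by rewrite /curve loc_frame. Qed.

Lemma curve0 : curve 0 = p.
Proof.
rewrite /curve -[dissection_curve _ _ _]/(mk3 0 (rho 0) (zeta (0, rho 0))).
rewrite rho0 zeta0 (_ : mk3 0 0 0 = 0) ?frame0//.
by apply: row3P; rewrite mk3E !mxE.
Qed.

Lemma curve_Pi s : `|s| < r -> `|rho s| < r -> Pi (curve s).
Proof.
move=> sr rr; apply/PiP; rewrite -[dissection_curve _ _ _]/(mk3 s (rho s) (zeta (s, rho s))).
  by apply/coord_boxP; rewrite !mk3E; split => //; exact: zetah.
by rewrite !mk3E.
Qed.

Lemma Pi_curve x : Pi x -> coord_box r h (loc p Q x) ->
  [/\ x = curve (loc p Q x 0 0), `|loc p Q x 0 0| < r & `|rho (loc p Q x 0 0)| < r].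
Proof.
move=> + bx; rewrite -{1}(frame_loc p x oQ) => /(PiP bx)[X2 X1].
move/coord_boxP: (bx) => [? X1r ?]; split => //; last by rewrite -X1.
rewrite -{1}(frame_loc p x oQ) /curve; congr frame_point.
rewrite -[dissection_curve _ _ _]/(mk3 (loc p Q x 0 0) (rho (loc p Q x 0 0)) (zeta (loc p Q x 0 0, rho (loc p Q x 0 0)))).
by rewrite -X1 -X2 mk3_coords.
Qed.

Lemma param_open a : `|a| < r -> `|rho a| < r -> exists2 d, 0 < d &
  forall s, `|s - a| < d -> `|s| < r /\ `|rho s| < r.
Proof.
move=> ar rar; exists (Num.min (r - `|a|) ((r - `|rho a|) / L)).
  by rewrite lt_min subr_gt0 ar divr_gt0// subr_gt0.
move=> s; rewrite lt_min => /andP[s1 s2].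
have sr : `|s| < r by have := ler_distD a s 0; rewrite !subr0; lra.
split => //; move: s2; rewrite ltr_pdivlMr// mulrC.
have := rhoL (ltW sr) (ltW ar); have := ler_distD (rho a) (rho s) 0.
by rewrite !subr0; lra.
Qed.

(** Exceeds the Lipschitz constants [1], [L] and [L * (1 + L)] of the three coordinates of the
    curve. *)
Definition K0 := 1 + L + L * (1 + L).
Definition curve_lip_const := 3 * K0.

Lemma curve_const_gt0 : 0 < K0.
Proof. by rewrite /K0 !addr_gt0// mulr_gt0// addr_gt0. Qed.

Lemma curve_lip s s' : `|s| < r -> `|rho s| < r -> `|s'| < r -> `|rho s'| < r ->
  `|curve s - curve s'| <= curve_lip_const * `|s - s'|.
Proof.
move=> s1 s2 s'1 s'2.
have rr := rhoL (ltW s1) (ltW s'1).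
have zz := zetaL (ltW s1) (ltW s2) (ltW s'1) (ltW s'2).
have n0 := normr_ge0 (s - s').
suff H : `|dissection_curve rho zeta s - dissection_curve rho zeta s'| <= K0 * `|s - s'|.
  by have := frame_lip p (dissection_curve rho zeta s) (dissection_curve rho zeta s') oQ;
    rewrite /curve_lip_const -mulrA; lra.
have LL : L * (`|s - s'| + `|rho s - rho s'|) <= L * (1 + L) * `|s - s'|.
  by rewrite -mulrA ler_pM2l//; lra.
have Lp : 0 < L * (1 + L) by rewrite mulr_gt0// addr_gt0.
have [k1 k2 k3] : [/\ 1 <= K0, L <= K0 & L * (1 + L) <= K0].
  by rewrite /K0; move: L0 => L0'; split; lra.
have K1 := ler_wpM2r n0 k1.
have K2 := ler_wpM2r n0 k2.
have K3 := ler_wpM2r n0 k3.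
apply: norm3_le; rewrite coordB !mk3E; lra.
Qed.

Lemma param_lip x y : `|loc p Q x 0 0 - loc p Q y 0 0| <= 3 * `|x - y|.
Proof. by rewrite -coordB; apply: le_trans (coord_le_norm _ _) (loc_lip _ _ _ oQ). Qed.

(** Retraction onto [[-r, r]], 1-Lipschitz: it makes the wall function Lipschitz on the whole space
    although [rho] is controlled on the interval only. *)
Definition clamp (s : R) := Num.max (- r) (Num.min r s).

Lemma clamp_id s : `|s| <= r -> clamp s = s.
Proof.
rewrite ler_norml => /andP[s1 s2].
by rewrite /clamp (min_idPr s2) (max_idPr s1).
Qed.

Lemma clamp_le s : `|clamp s| <= r.
Proof.
rewrite ler_norml /clamp le_max lexx /= ge_max ge_min lexx /= andbT.
by move: (r0) => r0'; lra.
Qed.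

Lemma clamp_lip s s' : `|clamp s - clamp s'| <= `|s - s'|.
Proof.
rewrite /clamp; move: (r0) => r0'.
have D := ler_norm (s - s'); have D' := ler_norm (s' - s); rewrite (distrC s') in D'.
have n0 := normr_ge0 (s - s').
have [a1|a1] := leP r s; have [a2|a2] := leP r s';
  rewrite ?(max_idPr (_ : - r <= r)); try lra;
  have [b1|b1] := leP (- r) s; have [b2|b2] := leP (- r) s';
  by rewrite ler_norml; lra.
Qed.

Definition wall_fun x := loc p Q x 0 1 - rho (clamp (loc p Q x 0 0)).

Lemma wall_fun_lip : lipschitz_fun wall_fun.
Proof.
exists (3 * (1 + L)); first by rewrite mulr_gt0// addr_gt0.
move=> x y; rewrite /wall_fun.
set X := loc p Q x; set Y := loc p Q y.
have h1 : `|X 0 1 - Y 0 1| <= 3 * `|x - y|.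
  by rewrite -coordB; apply: le_trans (coord_le_norm _ _) (loc_lip _ _ _ oQ).
have h2 : `|rho (clamp (X 0 0)) - rho (clamp (Y 0 0))| <= L * (3 * `|x - y|).
  apply: le_trans (rhoL (clamp_le _) (clamp_le _)) _; rewrite ler_pM2l//.
  exact: le_trans (clamp_lip _ _) (param_lip _ _).
have -> : X 0 1 - rho (clamp (X 0 0)) - (Y 0 1 - rho (clamp (Y 0 0))) =
  (X 0 1 - Y 0 1) - (rho (clamp (X 0 0)) - rho (clamp (Y 0 0))) by ring.
have := ler_normB (X 0 1 - Y 0 1) (rho (clamp (X 0 0)) - rho (clamp (Y 0 0))).
by lra.
Qed.

Lemma wall_fun_sign x : coord_box r h (loc p Q x) ->
  [/\ Gamma x -> wall_fun x < 0, Pi x -> wall_fun x = 0 & Gamma2 x -> 0 < wall_fun x].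
Proof.
move=> bx; have /coord_boxP[x0 _ _] := bx.
rewrite -{1 3 5}(frame_loc p x oQ) /wall_fun clamp_id ?(ltW x0)//.
split=> [/(GammaP bx)[_]|/(PiP bx)[_ ->]|/(Gamma2P bx)[_]]; rewrite ?subrr//.
  by rewrite subr_lt0.
by rewrite subr_gt0.
Qed.

(** The wall function does not depend on the vertical coordinate, so any multiple of the vertical
    may be added to the direction. *)
Lemma wall_fun_cone (c : R) q : cone_dir [set x | wall_fun x < 0] q (row 1 Q + c *: row 2 Q).
Proof.
have L1 : 0 < 1 + L by rewrite addr_gt0.
pose e := (6 * (1 + L))^-1.
have e0 : 0 < e by rewrite invr_gt0 mulr_gt0.
have eE : e * (6 * (1 + L)) = 1 by rewrite mulVf// gt_eqF// mulr_gt0.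
exists e => // x w s /=; rewrite /wall_fun => gx _ wu /andP[s0 _].
rewrite loc_step; set X := loc p Q x in gx *; set W := w *m Q^T.
have Wn : `|W - mk3 0 1 c| <= 3 * `|w - (row 1 Q + c *: row 2 Q)|.
  have -> : W - mk3 0 1 c = (w - (row 1 Q + c *: row 2 Q)) *m Q^T.
    rewrite mulmxBl mulmxDl -scalemxAl !(row_mulT oQ) -/W; congr (_ - _).
    by apply: row3P; rewrite coordD coordZ !mk3E; ring.
  exact: norm_mul_orthogonal _ (orthogonal_tr oQ).
have Wi i : `|W 0 i - mk3 0 1 c 0 i| <= 3 * e.
  by rewrite -coordB; apply: le_trans (coord_le_norm _ _) _; lra.
have := Wi 0; have := Wi 1; rewrite !mk3E subr0 => W1 W0.
have := rhoL (clamp_le (X 0 0 - s * W 0 0)) (clamp_le (X 0 0)).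
have cl : `|clamp (X 0 0 - s * W 0 0) - clamp (X 0 0)| <= s * (3 * e).
  apply: le_trans (clamp_lip _ _) _.
  by rewrite addrAC subrr add0r normrN normrM (gtr0_norm s0) ler_pM2l.
rewrite !stepE.
set A := rho _ in gx *; set B := rho _ => BA.
have : `|B - A| <= L * (s * (3 * e)) by apply: le_trans BA _; rewrite ler_pM2l.
rewrite ler_norml => /andP[BA' _].
move: W1; rewrite ler_norml => /andP[W1 _].
have : s * (1 - 3 * e) <= s * W 0 1 by rewrite ler_pM2l//; lra.
have : s * (e * (6 * (1 + L))) = s by rewrite eE mulr1.
have : 0 < s * e by rewrite mulr_gt0.
have : 0 < s * (e * L) by rewrite !mulr_gt0.
by lra.
Qed.

Section Tangent.
Variables (a : R) (t : E3).
Hypotheses (ar : `|a| < r) (rar : `|rho a| < r).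
Hypothesis tangent : strict_tangent Pi (curve a) t.
Let T := t *m Q^T.

Lemma tangent_param (e : R) : 0 < e -> exists2 d, 0 < d & forall s s', `|s - a| < d -> `|s' - a| < d ->
  exists2 l, `|curve s - curve s' - l *: t| <= e * `|s - s'| &
             `|s - s' - l * T 0 0| <= 3 * e * `|s - s'|.
Proof.
move=> e0; have K0 := curve_const_gt0.
have C0 : 0 < curve_lip_const by rewrite mulr_gt0.
have [d d0 dP] := tangent (divr_gt0 e0 C0).
have [b b0 bP] := param_open ar rar.
exists (Num.min b (d / curve_lip_const)); first by rewrite lt_min b0 divr_gt0.
move=> s s'; rewrite !lt_min => /andP[s1 s2] /andP[s'1 s'2].
have [sr rsr] := bP _ s1; have [s'r rs'r] := bP _ s'1.
have near c : `|c| < r -> `|rho c| < r -> `|c - a| < d / curve_lip_const ->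
    `|curve c - curve a| < d.
  move=> cr rcr; rewrite ltr_pdivlMr// mulrC; apply: le_lt_trans.
  exact: curve_lip.
have [l Hl] := dP _ _ (curve_Pi sr rsr) (curve_Pi s'r rs'r) (near _ sr rsr s2) (near _ s'r rs'r s'2).
have Hl' : `|curve s - curve s' - l *: t| <= e * `|s - s'|.
  apply: le_trans Hl _; rewrite mulrAC ler_pdivrMr// -mulrA ler_pM2l//.
  by rewrite mulrC; exact: curve_lip.
exists l => //.
have -> : s - s' - l * T 0 0 = ((curve s - curve s' - l *: t) *m Q^T) 0 0.
  by rewrite mulmxBl -scalemxAl -(locB p) !curve_loc stepE coordB !mk3E.
apply: le_trans (coord_le_norm _ _) _.
apply: le_trans (norm_mul_orthogonal _ (orthogonal_tr oQ)) _.
by rewrite -mulrA ler_pM2l.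
Qed.

(** The first local coordinate along the curve is the parameter itself. If [t] had none, a parameter
    increment would be at most half of itself. *)
Lemma tangent_coord0 : T 0 0 != 0.
Proof.
apply/eqP => T0; have [|d d0 dP] := @tangent_param (1 / 6); first lra.
have s0 : 0 < d / 2 by lra.
have [||l _] := dP (a + d / 2) a; rewrite ?subrr ?normr0//.
  by rewrite addrAC subrr add0r gtr0_norm; lra.
rewrite T0 mulr0 subr0 addrAC subrr add0r gtr0_norm//.
by lra.
Qed.

(** Differentiability is deduced from the tangent of the set [Pi], not from smoothness of this
    parametrization, so a tangent found in another chart serves here. *)
Lemma curve_strict (e : R) : 0 < e -> exists2 d, 0 < d & forall s s', `|s - a| < d -> `|s' - a| < d ->
  `|curve s - curve s' - ((s - s') / T 0 0) *: t| <= e * `|s - s'|.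
Proof.
move=> e0; have T0 := tangent_coord0.
have nT : 0 < `|T 0 0| by rewrite normr_gt0.
have nt := normr_ge0 t.
pose e1 := e / (1 + 3 * (`|t| / `|T 0 0|)).
have f0 : 0 <= `|t| / `|T 0 0| by rewrite divr_ge0.
have e10 : 0 < e1 by rewrite divr_gt0//; lra.
have e1E : e1 + 3 * e1 * (`|t| / `|T 0 0|) = e.
  by rewrite /e1; field; rewrite gt_eqF//=; lra.
have [d d0 dP] := tangent_param e10.
exists d => // s s' sd s'd; have [l H1 H2] := dP _ _ sd s'd.
have -> : curve s - curve s' - ((s - s') / T 0 0) *: t =
    (curve s - curve s' - l *: t) + (l - (s - s') / T 0 0) *: t.
  by rewrite scalerBl addrA subrK.
apply: le_trans (ler_normD _ _) _.
have lE : `|l - (s - s') / T 0 0| <= 3 * e1 * `|s - s'| / `|T 0 0|.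
  rewrite ler_pdivlMr// -normrM mulrBl divfK// distrC.
  by [].
have H3 : `|(l - (s - s') / T 0 0) *: t| <= 3 * e1 * (`|t| / `|T 0 0|) * `|s - s'|.
  rewrite normrZ; apply: le_trans (ler_wpM2r nt lE) _.
  by rewrite le_eqVlt; apply/orP; left; apply/eqP; field; rewrite gt_eqF.
have -> : e * `|s - s'| = e1 * `|s - s'| + 3 * e1 * (`|t| / `|T 0 0|) * `|s - s'|.
  by rewrite -e1E mulrDl.
exact: lerD.
Qed.

(** The gradient of the wall function, [T 0 1 / T 0 0] being the derivative of [rho] at [a]. *)
Definition wall_normal : 'cV[R]_3 :=
  (row 1 Q)^T + (- (T 0 1 / T 0 0)) *: (row 0 Q)^T.

Lemma linform_wall_normal z :
  linform wall_normal z = (z *m Q^T) 0 1 - T 0 1 / T 0 0 * (z *m Q^T) 0 0.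
Proof.
have rowE i : (z *m (row i Q)^T) 0 0 = (z *m Q^T) 0 i.
  by rewrite !mxE; apply: eq_bigr => k _; rewrite !mxE.
by rewrite /wall_normal linformDl linformZl /linform !rowE mulNr.
Qed.

Lemma linform_wall_normal_tangent : linform wall_normal t = 0.
Proof. by rewrite linform_wall_normal -/T divfK ?subrr// tangent_coord0. Qed.

Lemma linform_wall_normal_vertical : linform wall_normal (row 2 Q) = 0.
Proof. by rewrite linform_wall_normal (row_mulT oQ) !mk3E mulr0 subrr. Qed.

Lemma wall_normal_neq0 : wall_normal != 0.
Proof.
apply/eqP => N0; have := linform_wall_normal (row 1 Q).
rewrite N0 linform0 (row_mulT oQ) !mk3E mulr0 subr0 => /esym/eqP.
by rewrite oner_eq0.
Qed.

Lemma strict_diff_wall_fun : strict_diff wall_fun (curve a) wall_normal.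
Proof.
move=> e e0; have e90 : 0 < e / 9 by lra.
have [d d0 dP] := curve_strict e90.
have [b b0 bP] := param_open ar rar.
exists (Num.min d b / 3); first by rewrite divr_gt0// lt_min d0.
move=> x y xp yp.
have near z : `|z - curve a| < Num.min d b / 3 ->
    `|loc p Q z 0 0 - a| < d /\ `|loc p Q z 0 0| < r.
  move=> zc; have := param_lip z (curve a); rewrite curve_loc mk3E => H.
  have : `|loc p Q z 0 0 - a| < Num.min d b by lra.
  by rewrite lt_min => /andP[-> /bP[->]].
have [xd xr] := near _ xp; have [yd yr] := near _ yp.
have H := dP _ _ xd yd.
rewrite /wall_fun (clamp_id (ltW xr)) (clamp_id (ltW yr)) linform_wall_normal -(locB p).
set X := loc p Q x in xd xr H *; set Y := loc p Q y in yd yr H *.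
have H1 : `|rho (X 0 0) - rho (Y 0 0) - (X 0 0 - Y 0 0) / T 0 0 * T 0 1| <= 3 * (e / 9 * `|X 0 0 - Y 0 0|).
  have -> : rho (X 0 0) - rho (Y 0 0) - (X 0 0 - Y 0 0) / T 0 0 * T 0 1 =
      ((curve (X 0 0) - curve (Y 0 0) - ((X 0 0 - Y 0 0) / T 0 0) *: t) *m Q^T) 0 1.
    by rewrite mulmxBl -scalemxAl -(locB p) !curve_loc stepE coordB !mk3E.
  apply: le_trans (coord_le_norm _ _) _.
  apply: le_trans (norm_mul_orthogonal _ (orthogonal_tr oQ)) _.
  by rewrite ler_pM2l.
have -> : X 0 1 - rho (X 0 0) - (Y 0 1 - rho (Y 0 0)) -
    ((X - Y) 0 1 - T 0 1 / T 0 0 * (X - Y) 0 0) =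
    - (rho (X 0 0) - rho (Y 0 0) - (X 0 0 - Y 0 0) / T 0 0 * T 0 1).
  by rewrite !coordB; ring.
rewrite normrN; apply: le_trans H1 _.
have := param_lip x y; rewrite -/X -/Y => H2.
have : e / 9 * `|X 0 0 - Y 0 0| <= e / 9 * (3 * `|x - y|) by rewrite ler_pM2l.
by lra.
Qed.

End Tangent.

Lemma coord_box_open x : coord_box r h (loc p Q x) -> exists2 d, 0 < d &
  forall y, `|y - x| < d -> coord_box r h (loc p Q y).
Proof.
move=> /coord_boxP[x0 x1 x2].
pose m := Num.min (r - `|loc p Q x 0 0|) (Num.min (r - `|loc p Q x 0 1|) (h - `|loc p Q x 0 2|)).
have m0 : 0 < m by rewrite !lt_min !subr_gt0 x0 x1.
exists (m / 3) => [|y yx]; first by rewrite divr_gt0.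
have yi i : `|loc p Q y 0 i| < `|loc p Q x 0 i| + m.
  have : `|loc p Q y 0 i - loc p Q x 0 i| <= 3 * `|y - x|.
    by rewrite -coordB; apply: le_trans (coord_le_norm _ _) (loc_lip _ _ _ oQ).
  by have := ler_distD (loc p Q x 0 i) (loc p Q y 0 i) 0; rewrite !subr0; lra.
have [m1 m2 m3] : [/\ m <= r - `|loc p Q x 0 0|, m <= r - `|loc p Q x 0 1| & m <= h - `|loc p Q x 0 2|].
  by split; rewrite !ge_min lexx ?orbT.
by apply/coord_boxP; split; apply: (lt_le_trans (yi _)); rewrite addrC -lerBrDr.
Qed.

Lemma near_box : exists2 d, 0 < d & forall x, `|x - p| < d -> coord_box r h (loc p Q x).
Proof. by apply: coord_box_open; rewrite locpp; exact: coord_box0. Qed.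

Hypothesis rhozetaC1 : C1_except_finite [set t | `|t| < r /\ `|rho t| < r]
  (dissection_curve rho zeta).

(** The exceptional parameters are finitely many, so near [p] only the parameter 0 of [p] can be
    exceptional. Elsewhere the derivative of the curve is a strict tangent. *)
Lemma Pi_strict_tangent : exists2 d, 0 < d & forall x, Pi x -> `|x - p| < d ->
  x <> p -> exists t, strict_tangent Pi x t.
Proof.
have [F [finF FC1]] := rhozetaC1.
have [d1 d10 F0] := finite_gap 0 finF.
have [d2 d20 d2P] := near_box.
(* Local coordinates are 3-Lipschitz, so [d1 / 3] keeps the parameter of [x] below the gap [d1]. *)
exists (Num.min d2 (d1 / 3)); first by rewrite lt_min d20 divr_gt0.
move=> x Px; rewrite lt_min => /andP[/d2P bx x1] xp.
have [] := Pi_curve Px bx; set a := loc p Q x 0 0 => xa ar rar.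
have a0 : a <> 0 by move=> a0; apply: xp; rewrite xa a0 curve0.
have aF : ~ F a.
  move=> Fa; have := F0 _ Fa a0; rewrite subr0 => H.
  have := param_lip x p; rewrite [loc p Q p]locpp [X in `|_ - X|]mxE subr0 -/a; lra.
have [da cda] := FC1 a (conj (conj ar rar) aF).
have [d3 d30 F3] := finite_gap a finF.
have [b b0 bP] := param_open ar rar.
exists (derive1 (dissection_curve rho zeta) a *m Q) => e e0.
have e90 : 0 < e / 9 by lra.
have [||d d0 dP] := @C1_strict R (dissection_curve rho zeta) a (Num.min b d3) _ _ cda _ e90.
- by rewrite lt_min b0.
- move=> s; rewrite lt_min => /andP[/bP sr s3].
  have [->//|sa] := eqVneq s a.
  have nFs : ~ F s by move=> Fs; have := F3 _ Fs (elimN eqP sa); rewrite leNgt s3.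
  by have [] := FC1 s (conj sr nFs).
have [d4 d40 d4P] := coord_box_open bx.
exists (Num.min d4 (d / 3)); first by rewrite lt_min d40 divr_gt0.
move=> y z Py Pz; rewrite !lt_min => /andP[/d4P yb yd] /andP[/d4P zb zd].
have [yE _ _] := Pi_curve Py yb; have [zE _ _] := Pi_curve Pz zb.
set s := loc p Q y 0 0 in yE; set s' := loc p Q z 0 0 in zE.
have near c : `|c - x| < d / 3 -> `|loc p Q c 0 0 - a| < d.
  by move=> cx; have := param_lip c x; rewrite -/a; lra.
exists (s - s'); rewrite {1}yE {1}zE /curve frameB scalemxAl -mulmxBl.
have H1 := dP s s' (near _ yd) (near _ zd).
have := norm_mul_orthogonal (dissection_curve rho zeta s - dissection_curve rho zeta s' - (s - s') *: (dissection_curve rho zeta)^`()%classic a) oQ.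
have := param_lip y z; rewrite -/s -/s' => H2 H3; apply: le_trans H3 _.
have : e / 9 * `|s - s'| <= e / 9 * (3 * `|y - z|) by rewrite ler_pM2l.
by lra.
Qed.

Variable Omega : set E3.
Hypotheses (oO : open Omega) (GammaB : Gamma `<=` boundary Omega)
  (PiB : Pi `<=` boundary Omega) (coneO : cone_dir Omega p (row 2 Q)).

(** For small [s > 0], [p + s *: secant (slope s)] is the point of the graph over [(0, - s)], which
    is in [Gamma] since [rho 0 = 0]. *)
Definition slope (s : R) := zeta (0, - s) / s.
Definition secant (s : R) := mk3 0 (- 1) s *m Q.

Lemma slope_bound s : 0 < s < r -> `|slope s| <= L.
Proof.
move=> /andP[s0 sr]; rewrite /slope normrM normfV (gtr0_norm s0) ler_pdivrMr//.
have /zetaL : `|0 : R| <= r by rewrite normr0 ltW.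
move=> /(_ (- s) 0 0); rewrite zeta0 subr0 normr0 normrN (gtr0_norm s0).
rewrite subr0 normr0 add0r subr0 normrN (gtr0_norm s0).
by apply; exact: ltW.
Qed.

Lemma secant_Gamma s : 0 < s < r -> Gamma (p + s *: secant (slope s)).
Proof.
move=> /andP[s0 sr]; rewrite /secant scalemxAl -/(frame_point p Q _).
have E : s *: mk3 0 (- 1) (slope s) = mk3 0 (- s) (zeta (0, - s)).
  apply: row3P; rewrite coordZ !mk3E ?mulr0 ?mulrN1//.
  by rewrite /slope mulrC divfK// gt_eqF.
rewrite E; apply/GammaP; rewrite ?mk3E.
  apply/coord_boxP; rewrite !mk3E normr0 normrN (gtr0_norm s0); split => //.
  by apply: zetah; rewrite ?normr0// normrN gtr0_norm.
by rewrite rho0 oppr_lt0.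
Qed.

Lemma secant_lip s s' : `|secant s - secant s'| <= 3 * `|s - s'|.
Proof.
rewrite /secant -mulmxBl; apply: le_trans (norm_mul_orthogonal _ oQ) _.
rewrite ler_pM2l//; apply: norm3_le; rewrite coordB !mk3E ?subrr ?normr0//.
Qed.

(** The slopes are bounded by [L], so they have a cluster point as [s] tends to 0 from the right. *)
Lemma secant_limit : exists th : R, forall e : R, 0 < e -> exists2 s,
  0 < s < Num.min e r & `|secant (slope s) - secant th| < e.
Proof.
have cL := @segment_compact R (- L) L.
have F1 : (slope @ (0 : R)^'+) `[- L, L]%classic.
  change (\forall s \near (0 : R)^'+, `[- L, L]%classic (slope s)).
  near=> s; rewrite /= in_itv/= -ler_norml; apply: slope_bound; apply/andP; split.
    by near: s; exact: nbhs_right_gt.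
  by near: s; exact: nbhs_right_lt.
have [th [_ cl]] := cL (slope @ (0 : R)^'+) _ F1.
exists th => e e0.
have A : (slope @ (0 : R)^'+) [set slope s | s in [set s | 0 < s < Num.min e r]].
  change (\forall s \near (0 : R)^'+, [set slope s | s in [set s | 0 < s < Num.min e r]] (slope s)).
  near=> s; exists s => //=; apply/andP; split.
    by near: s; exact: nbhs_right_gt.
  by near: s; apply: nbhs_right_lt; rewrite lt_min e0.
have B : nbhs th [set x | `|x - th| < e / 3].
  by apply/(@near_normP R R^o); exists (e / 3) => //; rewrite divr_gt0.
have [_ [[s ss <-] /= sth]] := cl _ _ A B.
exists s => //; have := secant_lip (slope s) th; lra.
Unshelve. all: by end_near. Qed.

Lemma secant_eqP x y c z t (s t0 a b : R) : s = t0 * b ->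
  x + s *: z - c - t0 *: (a *: t + b *: y) =
  s *: (z - y) - (c - x - (- (t0 * a)) *: t).
Proof. by move=> ->; apply/rowP => i; rewrite !mxE; ring. Qed.

Lemma secant_eqN x y c z t (s t0 a b : R) : s = - (t0 * b) ->
  c - (x + s *: z) - t0 *: (a *: t + b *: y) =
  (c - x - (t0 * a) *: t) - s *: (z - y).
Proof. by move=> ->; apply/rowP => i; rewrite !mxE; ring. Qed.

(** The vector is a limit of secants between a point of [Gamma], which supplies the multiple of
    [secant th], and a point of [Pi], which supplies the multiple of [t]. The sign of [b] decides
    which of the two comes first. *)
Lemma secant_not_cone_dir t th (a b : R) : strict_tangent Pi p t ->
  (forall e : R, 0 < e -> exists2 s,
     0 < s < Num.min e r & `|secant (slope s) - secant th| < e) ->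
  b != 0 -> ~ cone_dir Omega p (a *: t + b *: secant th).
Proof.
move=> tt lim b0; apply: secant_not_cone => // e e0.
have z0 : `|0 : R| < r by rewrite normr0.
have rz0 : `|rho 0| < r by rewrite rho0 normr0.
rewrite -curve0 in tt.
set T0 := (t *m Q^T) 0 0.
have T00 : T0 != 0 by exact: (tangent_coord0 z0 rz0 tt).
have na := normr_ge0 a.
have nT := normr_ge0 T0.
have nb : 0 < `|b| by rewrite normr_gt0.
pose k := `|a * T0| + 1.
have k0 : 0 < k by rewrite /k; have := normr_ge0 (a * T0); lra.
have e2k : 0 < e / (2 * k) by rewrite divr_gt0// mulr_gt0.
have [d d0 dP] := curve_strict z0 rz0 tt e2k.
have [d2 d20 d2P] := param_open z0 rz0.
pose ny := `|secant th| + 1.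
have ny0 : 0 < ny by rewrite /ny; have := normr_ge0 (secant th); lra.
have C0 : 0 < curve_lip_const by rewrite mulr_gt0//; exact: curve_const_gt0.
pose m := Num.min (Num.min (e / (2 * `|b|)) 1) (Num.min (Num.min (e * `|b|) (e / ny))
   (Num.min (Num.min (d * `|b| / k) (d2 * `|b| / k)) (e * `|b| / (k * curve_lip_const)))).
have m0 : 0 < m.
  by rewrite !lt_min; repeat (apply/andP; split) => //;
    repeat (first [done|apply: divr_gt0|apply: mulr_gt0]).
have [s /andP[s0 sm] sth] := lim _ m0.
have [m1 m2 m3 m4] : [/\ m <= e / (2 * `|b|), m <= 1, m <= e * `|b| & m <= e / ny].
  by split; rewrite !ge_min lexx ?orbT.
have [m5 m6 m7] : [/\ m <= d * `|b| / k, m <= d2 * `|b| / k & m <= e * `|b| / (k * curve_lip_const)].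
  by split; rewrite !ge_min lexx ?orbT.
move: sm; rewrite lt_min => /andP[sm sr].
have G : Gamma (p + s *: secant (slope s)) by apply: secant_Gamma; rewrite s0.
(* With scale [t0], the point of [Gamma] is displaced by about [t0 * |b|] along [secant th]. The
   curve parameter of size [|t0 * a * T0|] displaces the point of [Pi] by about [t0 * |a|] times
   [t], up to sign. *)
pose t0 := s / `|b|.
have t00 : 0 < t0 by rewrite divr_gt0.
have t0b : t0 * `|b| = s by rewrite divfK// gt_eqF.
have par (c : R) : `|c| = `|t0 * a * T0| -> [/\ `|c - 0| < d, Pi (curve c) & `|curve c - p| < e].
  move=> cE.
  have ck : `|c| * `|b| <= s * k.
    rewrite cE -mulrA normrM (gtr0_norm t00) mulrAC t0b ler_pM2l//.
    by rewrite /k; lra.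
  have c1 : `|c| < d.
    rewrite -(ltr_pM2r nb); apply: le_lt_trans ck _.
    by rewrite -ltr_pdivlMr//; exact: lt_le_trans sm m5.
  have c2 : `|c| < d2.
    rewrite -(ltr_pM2r nb); apply: le_lt_trans ck _.
    by rewrite -ltr_pdivlMr//; exact: lt_le_trans sm m6.
  have [cr rcr] : `|c| < r /\ `|rho c| < r by apply: d2P; rewrite subr0.
  split; [by rewrite subr0|exact: curve_Pi|].
  rewrite -{1}curve0; apply: le_lt_trans (curve_lip cr rcr z0 rz0) _.
  rewrite subr0 -(ltr_pM2r nb) -mulrA.
  apply: le_lt_trans (_ : curve_lip_const * (s * k) < _); first by rewrite ler_pM2l.
  have kC : 0 < k * curve_lip_const by rewrite mulr_gt0.
  have -> : curve_lip_const * (s * k) = s * (k * curve_lip_const) by ring.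
  by rewrite -ltr_pdivlMr//; exact: lt_le_trans sm m7.
have d00 : `|0 - 0 : R| < d by rewrite subr0 normr0.
have est (c : R) : `|c| = `|t0 * a * T0| -> `|curve c - p - (c / T0) *: t| <= e / 2 * t0.
  move=> cE; have [cd _ _] := par _ cE.
  have := dP _ _ cd d00; rewrite curve0 !subr0 => H; apply: le_trans H _.
  have ck : `|c| <= t0 * k.
    by rewrite cE -mulrA normrM (gtr0_norm t00) ler_pM2l// /k; lra.
  have -> : e / 2 * t0 = e / (2 * k) * (t0 * k) by field; rewrite gt_eqF.
  by rewrite ler_pM2l.
have xs : `|p + s *: secant (slope s) - p| < e.
  rewrite addrAC subrr add0r normrZ (gtr0_norm s0).
  have : `|secant (slope s)| < ny.
    by rewrite /ny; have := ler_distD (secant th) (secant (slope s)) 0; rewrite !subr0; lra.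
  move=> sn; apply: le_lt_trans (_ : s * ny < e); first by rewrite ler_pM2l// ltW.
  by rewrite -ltr_pdivlMr//; exact: lt_le_trans sm m4.
have t0e : 0 < t0 < e.
  by rewrite t00 /= /t0 ltr_pdivrMr//; exact: lt_le_trans sm m3.
have sE : `|s *: (secant (slope s) - secant th)| <= e / 2 * t0.
  have -> : e / 2 * t0 = s * (e / (2 * `|b|)) by rewrite /t0; field; rewrite gt_eqF.
  by rewrite normrZ (gtr0_norm s0) ler_pM2l// ltW// (lt_le_trans sth).
have [bpos|bneg] := ltP 0 b.
  have [_ cP _] := par (- (t0 * a * T0)) (normrN _).
  have eP := est (- (t0 * a * T0)) (normrN _).
  exists (p + s *: secant (slope s)), (curve (- (t0 * a * T0))), t0; split => //.
  - exact: GammaB.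
  - exact: PiB.
  have sb : s = t0 * b by rewrite -[LHS]t0b (gtr0_norm bpos).
  move: eP; rewrite mulNr (mulfK T00) => eP.
  rewrite (secant_eqP _ _ _ _ _ _ sb).
  by apply: le_trans (ler_normB _ _) _; lra.
have [_ cP cn] := par (t0 * a * T0) erefl.
have eP := est (t0 * a * T0) erefl.
exists (curve (t0 * a * T0)), (p + s *: secant (slope s)), t0; split => //.
- exact: PiB.
- exact: GammaB.
have sb : s = - (t0 * b) by rewrite -[LHS]t0b (ler0_norm bneg) mulrN.
move: eP; rewrite (mulfK T00) => eP.
rewrite (secant_eqN _ _ _ _ _ _ sb).
by apply: le_trans (ler_normB _ _) _; lra.
Qed.

Lemma tangent_frame t : strict_tangent Pi p t -> exists v0 y,
  [/\ cone_dir Omega p v0,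
      forall a b : R, ~ cone_dir Omega p (a *: t + b *: y),
      forall z, exists a b c : R, z = a *: v0 + b *: y + c *: t &
      forall e : R, 0 < e -> exists (s : R) z,
        [/\ 0 < s < e, `|z - y| < e & Gamma (p + s *: z)]].
Proof.
move=> tt; have [th lim] := secant_limit.
exists (row 2 Q), (secant th); split => //.
(* For [b = 0], openness of the cone would allow adding a small positive multiple of [secant th],
   which is the case already excluded. *)
- move=> a b; have [->|] := eqVneq b 0; last exact: secant_not_cone_dir.
  rewrite scale0r addr0 => /cone_dir_open[e e0 eP].
  have n0 : 0 < `|secant th| + 1 by have := normr_ge0 (secant th); lra.
  have c0 : 0 < e / (`|secant th| + 1) by rewrite divr_gt0.
  apply: (@secant_not_cone_dir t th a (e / (`|secant th| + 1))) => //.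
    by rewrite gt_eqF.
  apply: eP; rewrite addrAC subrr add0r normrZ (gtr0_norm c0) mulrAC ltr_pdivrMr//.
  by rewrite ltr_pM2l//; lra.
- move=> z; pose Z := z *m Q^T; pose T := t *m Q^T.
  have T0 : T 0 0 != 0.
    by apply: (@tangent_coord0 0) => //; rewrite ?rho0 ?normr0 ?curve0.
  pose c := Z 0 0 / T 0 0.
  pose b := c * T 0 1 - Z 0 1.
  pose a := Z 0 2 - c * T 0 2 - b * th.
  exists a, b, c.
  have E : Z = a *: mk3 0 0 1 + b *: mk3 0 (- 1) th + c *: T.
    apply: row3P; rewrite !coordD !coordZ !mk3E /a /b /c; first by field.
      by ring.
    by ring.
  have QQ : Q^T *m Q = 1%:M by apply: mulmx1C.
  have -> : z = Z *m Q by rewrite -mulmxA QQ mulmx1.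
  rewrite E !mulmxDl -!scalemxAl -/(secant th) -mulmxA QQ mulmx1.
  by rewrite mk3_mul !scale0r !add0r scale1r.
- move=> e e0; have [s /andP[s0]] := lim e e0; rewrite lt_min => /andP[se sr] sth.
  exists s, (secant (slope s)); split => //; first by rewrite s0.
  by apply: secant_Gamma; rewrite s0.
Qed.

End Chart.

(** * Local wall functions and their properties *)

Section WallCharts.
Context {R : realType}.
Local Notation E3 := 'rV[R]_3.
Implicit Types (x y z p q u v t : E3).

(** Only the centre [q] may lack a tangent in the ball. Where a tangent exists, the differential of
    [g] kills it and some direction of [Omega]. The last clause replaces the differential at a
    centre without tangent. *)
Definition wall_chart (Omega Gamma Pi Gamma2 : set E3) q (e : R) (g : E3 -> R) :=
  [/\ 0 < e, lipschitz_fun g,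
      forall x, boundary Omega x -> `|x - q| < e ->
        [/\ Gamma x -> g x < 0, Pi x -> g x = 0 & Gamma2 x -> 0 < g x],
      forall x, Pi x -> `|x - q| < e ->
        (x <> q -> exists t, strict_tangent Pi x t) /\
        (forall t, strict_tangent Pi x t -> exists N v,
           [/\ N != 0, cone_dir Omega x v, strict_diff g x N, linform N v = 0 & linform N t = 0]) &
      Pi q -> exists u u',
        [/\ cone_dir [set x | g x < 0] q u, cone_dir Omega q u,
            cone_dir [set x | g x < 0] q u' & cone_dir Omega q (- u')]].

Definition tangent_frame_at (Omega Gamma Pi : set E3) p :=
  forall t, strict_tangent Pi p t -> exists v0 y,
  [/\ cone_dir Omega p v0,
      forall a b : R, ~ cone_dir Omega p (a *: t + b *: y),
      forall z, exists a b c : R, z = a *: v0 + b *: y + c *: t &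
      forall e : R, 0 < e -> exists (s : R) z,
        [/\ 0 < s < e, `|z - y| < e & Gamma (p + s *: z)]].

Lemma dissection_chart (Omega Gamma Pi Gamma2 : set E3) p Q (r h : R)
    (zeta : R * R -> R) (rho : R -> R) :
  open Omega -> Gamma `<=` boundary Omega -> Pi `<=` boundary Omega -> Pi p ->
  hypograph_in_box Omega p Q r h zeta ->
  [lipschitz rho t | t in `[-r, r] ] ->
  [/\ box_trace p Q r h Gamma = coord_box r h `&`
        [set x | x 0 2 = zeta (x 0 0, x 0 1) /\ x 0 1 < rho (x 0 0)],
      box_trace p Q r h Pi = coord_box r h `&`
        [set x | x 0 2 = zeta (x 0 0, x 0 1) /\ x 0 1 = rho (x 0 0)] &
      box_trace p Q r h Gamma2 = coord_box r h `&`
        [set x | x 0 2 = zeta (x 0 0, x 0 1) /\ x 0 1 > rho (x 0 0)]] ->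
  C1_except_finite [set t | `|t| < r /\ `|rho t| < r]
    (dissection_curve rho zeta) ->
  (exists e g, wall_chart Omega Gamma Pi Gamma2 p e g) /\
  tangent_frame_at Omega Gamma Pi p.
Proof.
move=> oO GB PB Pp hyp /lipschitz_boundP[L1 L10 rL1].
move=> [/box_traceP HG /box_traceP HP /box_traceP HG2] C1.
have coneO := hypograph_cone hyp.
have [[oQ r0 h0] /lipschitz_boundP[L2 L20 zL2] z0 zh _] := hyp.
pose L := Num.max L1 L2.
have L0 : 0 < L by rewrite lt_max L10.
have inI s : `|s| <= r -> `[- r, r]%classic s by rewrite /= in_itv/= -ler_norml.
have zetaL (a b a' b' : R) : `|a| <= r -> `|b| <= r -> `|a'| <= r ->
    `|b'| <= r -> `|zeta (a, b) - zeta (a', b')| <= L * (`|a - a'| + `|b - b'|).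
  move=> /inI ar /inI br /inI a'r /inI b'r.
  apply: le_trans (zL2 (a, b) (a', b') _ _) _ => //.
  rewrite prod_normE /=; apply: ler_pM.
  - exact: ltW.
  - by rewrite le_max normr_ge0.
  - by rewrite /L le_max lexx orbT.
  - by rewrite ge_max lerDl lerDr !normr_ge0.
have rhoL (a a' : R) : `|a| <= r -> `|a'| <= r -> `|rho a - rho a'| <= L * `|a - a'|.
  move=> /inI ar /inI a'r; apply: le_trans (rL1 _ _ ar a'r) _.
  by rewrite ler_wpM2r// /L le_max lexx.
have zetah (a b : R) : `|a| < r -> `|b| < r -> `|zeta (a, b)| < h.
  by move=> ar br; apply: zh; split; rewrite /= in_itv/= -ltr_norml.
split; last first.
  move=> t; exact: (tangent_frame oQ r0 h0 L0 zetaL rhoL zetah HG HP Pp oO GB PB coneO).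
have [d1 d10 d1P] := near_box p oQ r0 h0.
have [d2 d20 d2P] := Pi_strict_tangent oQ r0 h0 L0 rhoL HP Pp C1.
have [d3 d30 d3P] := coneO.
pose e := Num.min d1 (Num.min d2 (d3 / 2)).
have e0 : 0 < e by rewrite !lt_min d10 d20 divr_gt0.
exists e, (wall_fun p Q r rho); split => //.
- exact: (wall_fun_lip _ oQ r0 L0 rhoL).
- move=> x bx; rewrite lt_min => /andP[/d1P xb _].
  exact: (wall_fun_sign oQ HG HP HG2 xb).
- move=> x Px; rewrite !lt_min => /andP[/d1P xb /andP[xd2 xd3]]; split.
    exact: d2P.
  move=> t tt; have [xE ar rar] := Pi_curve oQ HP Px xb.
  rewrite xE in tt.
  exists (wall_normal Q t), (row 2 Q); split.
  + exact: wall_normal_neq0.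
  + apply: (cone_at_dir_near d30 d3P); first exact: ltW.
    by rewrite subrr normr0 ltW// divr_gt0.
  + rewrite {1}xE.
    exact: (strict_diff_wall_fun oQ L0 zetaL rhoL zetah HP ar rar tt).
  + exact: linform_wall_normal_vertical.
  + exact: (linform_wall_normal_tangent oQ L0 zetaL rhoL zetah HP ar rar tt).
- move=> _; have [d d0 dP] := cone_dir_open coneO.
  have n0 : 0 < `|row 1 Q| + 1 by have := normr_ge0 (row 1 Q); lra.
  (* So large that [row 2 Q] plus or minus [c^-1 *: row 1 Q] is still a direction for [Omega]:
     adding steep multiples of the vertical of either sign to [row 1 Q] gives the two vectors. *)
  pose c := (`|row 1 Q| + 1) / d.
  have c0 : 0 < c by rewrite divr_gt0.
  have near : `|c^-1 *: row 1 Q| < d.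
    rewrite normrZ gtr0_norm ?invr_gt0// /c invf_div mulrAC ltr_pdivrMr//.
    by rewrite ltr_pM2l//; lra.
  exists (row 1 Q + c *: row 2 Q), (row 1 Q + (- c) *: row 2 Q); split.
  + exact: (wall_fun_cone _ oQ r0 L0 rhoL).
  + have -> : row 1 Q + c *: row 2 Q = c *: (row 2 Q + c^-1 *: row 1 Q).
      by rewrite scalerDr scalerA divff ?gt_eqF// scale1r addrC.
    by apply: cone_dirZ => //; apply: dP; rewrite addrAC subrr add0r.
  + exact: (wall_fun_cone _ oQ r0 L0 rhoL).
  + have -> : - (row 1 Q + (- c) *: row 2 Q) = c *: (row 2 Q - c^-1 *: row 1 Q).
      by rewrite scalerBr scalerA divff ?gt_eqF// scale1r opprD scaleNr opprK addrC.
    by apply: cone_dirZ => //; apply: dP; rewrite addrAC subrr add0r normrN.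
Qed.

End WallCharts.

(** * Construction of the wall *)

Section WallExistence.
Context {R : realType}.
Local Notation E3 := 'rV[R]_3.
Implicit Types (x y z p q u v t : E3).

Lemma lipschitz_fun_continuous (f : E3 -> R) : lipschitz_fun f -> continuous f.
Proof.
move=> [M M0 H] x; apply/(@cvgrPdist_lt _ _ _ (nbhs x) (nbhs_filter x)) => e e0.
apply/near_normP.
exists (e / M) => [|y yx]; first by rewrite divr_gt0.
by rewrite distrC; apply: le_lt_trans (H _ _) _; rewrite mulrC -ltr_pdivlMr.
Qed.

Lemma continuous_near_lt0 (f : E3 -> R) p : {for p, continuous f} -> f p < 0 ->
  exists2 d, 0 < d & forall x, `|x - p| < d -> f x < 0.
Proof.
move=> /cvgrPdist_lt cf fp; have fp' : 0 < - f p by rewrite oppr_gt0.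
have /near_normP[d d0 dP] := cf _ fp'.
exists d => // x /dP /=; rewrite ltr_norml => /andP[]; lra.
Qed.

Lemma continuous_sum (I : Type) (r : seq I) (F : I -> E3 -> R) :
  (forall i, continuous (F i)) -> continuous (fun x => \sum_(i <- r) F i x).
Proof.
move=> H; elim: r => [|i r IH].
  have -> : (fun x => \sum_(i <- [::]) F i x) = fun=> 0.
    by apply/funext => x; rewrite big_nil.
  exact: cst_continuous.
have -> : (fun x => \sum_(j <- i :: r) F j x) =
    (F i \+ fun x => \sum_(j <- r) F j x).
  by apply/funext => x; rewrite big_cons.
by move=> x; apply: continuousD; [exact: H|exact: IH].
Qed.

(** The support has half the chart radius, so a point outside the ball of radius [e] has a
    neighborhood where the tent vanishes. *)
Definition tent q (e : R) x := Num.max 0 (e / 2 - `|x - q|).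

Lemma tent_ge0 q e x : 0 <= tent q e x.
Proof. by rewrite le_max lexx. Qed.

Lemma tent_gt0 q e x : (0 < tent q e x) = (`|x - q| < e / 2).
Proof. by rewrite lt_max ltxx subr_gt0. Qed.

Lemma tent_lip q e : lipschitz_fun (tent q e).
Proof.
exists 1 => // x y; rewrite mul1r /tent.
have := ler_distD y x q; have := ler_distD x y q; rewrite (distrC y x).
have [h1|h1] := leP 0 (e / 2 - `|x - q|); have [h2|h2] := leP 0 (e / 2 - `|y - q|);
  by rewrite ler_norml; lra.
Qed.

Lemma finite_radius (T : eqType) (s : seq T) (P : T -> E3 -> Prop) p :
  (forall i, i \in s -> exists2 d, 0 < d & forall x, `|x - p| < d -> P i x) ->
  exists2 d, 0 < d & forall x, `|x - p| < d -> forall i, i \in s -> P i x.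
Proof.
elim: s => [|q s IH] H; first by exists 1.
have [|d1 d10 H1] := IH; first by move=> q' q's; apply: H; rewrite inE q's orbT.
have [d2 d20 H2] := H q (mem_head _ _).
exists (Num.min d1 d2); first by rewrite lt_min d10.
move=> x; rewrite lt_min => /andP[x1 x2] q'; rewrite inE => /predU1P[->|q's].
  exact: H2.
exact: H1.
Qed.

(** The tents need not sum to 1, as only signs of [G] matter, nor be differentiable, as the local
    wall functions vanish on [Pi]. *)
Lemma wall_exists (Omega Gamma Pi Gamma2 : set E3) : open Omega ->
  compact (boundary Omega) -> boundary Omega = Gamma `|` Pi `|` Gamma2 ->
  (forall p, boundary Omega p -> exists u, cone_dir Omega p u) ->
  (forall q, boundary Omega q -> exists e g, wall_chart Omega Gamma Pi Gamma2 q e g) ->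
  (forall p, Pi p -> tangent_frame_at Omega Gamma Pi p) ->
  exists W : set E3, [/\ open W, Gamma `<=` W, forall p, Pi p -> ~ W p,
    forall p, Gamma2 p -> ~ closure W p &
    forall p, boundary Omega p -> exists u u',
      [/\ cone_dir W p u, cone_dir Omega p u,
          cone_dir W p u' & cone_dir Omega p (- u')]].
Proof.
move=> oO cO bOmega cones charts frames.
(* Off the boundary the pair [(0, fun=> 0)] is a dummy, chosen Lipschitz so that [G] is continuous
   without side conditions. *)
have /choice[eg egP] : forall q, exists eg : R * (E3 -> R),
    (boundary Omega q -> wall_chart Omega Gamma Pi Gamma2 q eg.1 eg.2) /\ lipschitz_fun eg.2.
  move=> q; have [/charts[e [g egq]]|nq] := pselect (boundary Omega q).
    by exists (e, g); split => //; case: egq.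
  by exists (0, fun=> 0); split => //; exists 1 => // x y; rewrite subrr normr0 mul1r.
pose e q := (eg q).1; pose g q := (eg q).2.
have chart q : boundary Omega q -> wall_chart Omega Gamma Pi Gamma2 q (e q) (g q).
  by move=> bq; exact: (egP q).1.
have glip q : lipschitz_fun (g q) by exact: (egP q).2.
pose phi q (x : E3) : R := tent q (e q) x.
have [s sb scover'] : exists2 s : seq E3, forall q, q \in s -> boundary Omega q &
    forall p, boundary Omega p -> exists2 q, q \in s & `|p - q| < e q / 2.
  have [D' D'b D'c] : finite_subset_cover (boundary Omega)
      (fun q => [set x : E3 | `|x - q| < e q / 2]) (boundary Omega).
    rewrite compact_cover in cO; apply: cO => [q bq|q bq].
      apply/open_normP => x /= xq; exists (e q / 2 - `|x - q|) => [|y yx].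
        by rewrite subr_gt0.
      by have := ler_distD x y q; lra.
    exists q => //=; rewrite subrr normr0 divr_gt0//.
    by have [] := chart q bq.
  exists (finmap.enum_fset D') => [q /D'b|p /D'c[q qs pq]]; first by rewrite inE.
  by exists q.
have scover p : boundary Omega p -> exists2 q, q \in s & 0 < phi q p.
  by move=> /scover'[q qs pq]; exists q => //; rewrite tent_gt0.
pose G (x : E3) : R := \sum_(q <- s) phi q x * g q x.
have Gc : continuous G.
  apply: continuous_sum => q x; apply: continuousM.
    exact: (lipschitz_fun_continuous (@tent_lip _ _)).
  exact: lipschitz_fun_continuous.
have phi0 q x : 0 <= phi q x by exact: tent_ge0.
have phie q x : boundary Omega q -> 0 < phi q x -> `|x - q| < e q.
  by move=> /chart[e0 _ _ _ _]; rewrite tent_gt0 => xq; lra.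
have sign q x : q \in s -> boundary Omega x -> `|x - q| < e q ->
    [/\ Gamma x -> g q x < 0, Pi x -> g q x = 0 & Gamma2 x -> 0 < g q x].
  by move=> /sb/chart[_ _ H _ _]; exact: H.
have GGamma x : Gamma x -> G x < 0.
  move=> Gx; have bx : boundary Omega x by rewrite bOmega; left; left.
  apply: (weighted_sum_lt0 (phi := phi ^~ x)) (scover _ bx) => // q qs pq.
  by have [H _ _] := sign q x qs bx (phie _ _ (sb _ qs) pq); exact: H.
have GPi x : Pi x -> G x = 0.
  move=> Px; have bx : boundary Omega x by rewrite bOmega; left; right.
  apply: (weighted_sum_eq0 (phi := phi ^~ x)) => // q qs pq.
  by have [_ H _] := sign q x qs bx (phie _ _ (sb _ qs) pq); exact: H.
have GGamma2 x : Gamma2 x -> 0 < G x.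
  move=> Gx; have bx : boundary Omega x by rewrite bOmega; right.
  apply: (weighted_sum_gt0 (phi := phi ^~ x)) (scover _ bx) => // q qs pq.
  by have [_ _ H] := sign q x qs bx (phie _ _ (sb _ qs) pq); exact: H.
have G2near p : Gamma2 p -> exists2 d, 0 < d & forall x, `|x - p| < d -> 0 < G x.
  move=> /GGamma2 Gp.
  have [||d d0 dP] := @continuous_near_lt0 (fun x => - G x) p; last first.
  - by exists d => // x /dP; rewrite oppr_lt0.
  - by rewrite oppr_lt0.
  - by apply: continuousN; exact: Gc.
exists [set x | G x < 0]; split.
- by apply/open_normP => x /= Gx; have [d d0 dP] := continuous_near_lt0 (Gc x) Gx; exists d.
- exact: GGamma.
- by move=> p /GPi /= ->; rewrite ltxx.
- move=> p /G2near[d d0 dP] /closure_normP/(_ _ d0)[x /= Gx /dP].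
  by rewrite ltNge (ltW Gx).
move=> p bp.
have [u cu] := cones p bp.
move: (bp); rewrite bOmega => -[[Gp|Pp]|/G2near[d d0 dP]]; last first.
(* Near a point of [Gamma2] the wall is empty, and near one of [Gamma] it is everything: both [u]
   and [- u] are then directions for it. *)
- exists u, (- u); rewrite opprK.
  by split => //; apply: (cone_dir_empty _ d0) => x /dP /= /ltW; rewrite leNgt => /negP.
- have [[t tt]|bad] := pselect (exists t, strict_tangent Pi p t).
    have [v0 [y [Cv0 Cty span secy]]] := frames p Pp t tt.
    (* Short secants into [Gamma] stay in the ball of every chart whose ball contains [p], so the
       same [y] tests all active differentials. *)
    have sec (q : E3) (k : R) : 0 < k -> `|p - q| < e q -> q \in s -> exists (s' : R) z,
        [/\ 0 < s' < k, `|z - y| < k & g q (p + s' *: z) < 0].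
      move=> k0 pq qs.
      have gap : 0 < e q - `|p - q| by rewrite subr_gt0.
      have [l /andP[l0 _] lP] := small_step y gap.
      have m0 : 0 < Num.min k l by rewrite lt_min k0.
      have [s' [z [/andP[s'0 s'm] zy Gz]]] := secy _ m0.
      move: s'm zy; rewrite !lt_min => /andP[s'k s'l] /andP[zk zl].
      exists s', z; split => //; first by rewrite s'0.
      have bz : boundary Omega (p + s' *: z) by rewrite bOmega; left; left.
      have zq : `|p + s' *: z - q| < e q.
        rewrite addrAC; have := ler_normD (p - q) (s' *: z).
        have := lP s' z zl; rewrite s'0 s'l => /(_ isT); lra.
      by have [H _ _] := sign q _ qs bz zq; exact: H.
    have /choice[N NP] : forall q, exists N : 'cV[R]_3, q \in s ->
        strict_diff (fun x => phi q x * g q x) p (phi q p *: N) /\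
        (0 < phi q p -> exists v, [/\ cone_dir Omega p v, linform N v = 0,
          linform N t = 0, linform N y <= 0 & N != 0]).
      move=> q; have [qs|] := boolP (q \in s); last by exists 0.
      have [e0 gl _ Hq _] := chart q (sb q qs).
      have [pq|pq] := ltP `|p - q| (e q).
        have [_ /(_ t tt)[N [v [N0 Cv sN Nv Nt]]]] := Hq p Pp pq.
        have gp : g q p = 0 by have [_ H _] := sign q p qs bp pq; exact: H.
        exists N => _; split; first exact: strict_diffM (@tent_lip _ _) gl gp sN.
        move=> _; exists v; split => //.
        by apply: (strict_diff_secant_le0 sN gp) => k k0; exact: sec.
      (* The tent of such a [q] vanishes near [p], so its term has zero differential and is not
         active. *)
      exists 0 => _; rewrite scaler0; split; last by move/(phie _ _ (sb q qs)); rewrite ltNge pq.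
      apply: (@strict_diff_locally0 _ _ _ (e q / 2)) => [|x xp]; first by rewrite divr_gt0.
      suff -> : phi q x = 0 by rewrite mul0r.
      apply/eqP; rewrite eq_le phi0 andbT leNgt tent_gt0 -leNgt.
      by have := ler_distD x p q; rewrite (distrC p x); lra.
    have /choice[v vP] : forall q, exists v, q \in s -> 0 < phi q p ->
        [/\ cone_dir Omega p v, linform (N q) v = 0, linform (N q) t = 0, linform (N q) y <= 0 & N q != 0].
      move=> q; have [[qs pq]|H] := pselect (q \in s /\ 0 < phi q p).
        by have [_ /(_ pq)[v vP]] := NP q qs; exists v.
      by exists 0 => qs pq; case: H.
    have sG : strict_diff G p (\sum_(q <- s) phi q p *: N q).
      by apply: strict_diff_sum => q /NP[].
    have [w [w' [Cw Nw Cw' Nw']]] : exists w w',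
        [/\ cone_dir Omega p w, 0 < linform (\sum_(q <- s) phi q p *: N q) w,
            cone_dir Omega p w' & linform (\sum_(q <- s) phi q p *: N q) w' < 0].
      apply: (@cone_both_signs _ (cone_dir Omega p) t y v0 _ _ _ Cv0 Cty span _ _ _ _ v) => //.
      + exact: cone_dir_open.
      + exact: cone_dirD.
      + by move=> c w; exact: cone_dirZ.
      + exact: scover.
    exists w, (- w'); rewrite opprK; split => //; first exact: strict_diff_cone sG Nw.
    by apply: strict_diff_cone sG _; rewrite linformN oppr_gt0.
  (* Any other chart whose ball contains [p] would provide a tangent there, against [bad]. *)
  have own q : q \in s -> `|p - q| < e q -> q = p.
    move=> qs pq; apply: contrapT => qp; apply: bad.
    have [_ _ _ Hq _] := chart q (sb q qs).
    by have [/(_ (fun E => qp (esym E)))] := Hq p Pp pq.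
  have ps : p \in s.
    by have [q qs pq] := scover p bp; rewrite -(own q qs (phie _ _ (sb _ qs) pq)).
  have [e0 _ _ _ /(_ Pp)[w [w' [Ww Ow Ww' Ow']]]] := chart p bp.
  have [d1 d10 d1P] : exists2 d, 0 < d & forall x, `|x - p| < d ->
      forall q, q \in s -> 0 < phi q x -> q = p.
    apply: finite_radius => q qs.
    have [->|qp] := eqVneq q p; first by exists 1.
    have eq0 : 0 < e q by have [] := chart q (sb q qs).
    exists (e q / 2) => [|x xp]; first by rewrite divr_gt0.
    rewrite tent_gt0 => xq; apply: own => //.
    by have := ler_distD x p q; rewrite (distrC p x); lra.
  have m0 : 0 < Num.min d1 (e p / 2) by rewrite lt_min d10 divr_gt0.
  (* Near [p] all tents but that of [p] vanish and the latter is positive, so [G] has the sign of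
     [g p]. *)
  have loc x : `|x - p| < Num.min d1 (e p / 2) -> [set x | g p x < 0] x <-> [set x | G x < 0] x.
    rewrite lt_min => /andP[/d1P x1 x2] /=; split => [gx|Gx].
      apply: (weighted_sum_lt0 (phi := phi ^~ x)) => // [q qs pq|].
        by rewrite (x1 q qs pq).
      by exists p => //; rewrite tent_gt0.
    rewrite ltNge; apply/negP => gx; move: Gx; rewrite ltNge => /negP; apply.
    rewrite /G big_seq; apply: sumr_ge0 => q qs.
    have := phi0 q x; rewrite le_eqVlt => /predU1P[<-|pq]; first by rewrite mul0r.
    by rewrite mulr_ge0// (x1 q qs pq).
  by exists w, w'; split => //; apply: (cone_dir_local m0 loc).
- exists u, (- u); rewrite opprK.
  have [d d0 dP] := continuous_near_lt0 (Gc p) (GGamma _ Gp).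
  by split => //; apply: (cone_dir_full _ d0).
Qed.

End WallExistence.

(** * From the dissection to its charts, the wall and the extension *)

Unset Implicit Arguments.

Theorem theorem2p3 (R : realType) (Omega Gamma Pi : set 'rV[R]_3)
    (hOmega : lipschitz_domain Omega)
    (hGamma : Gamma `<` boundary Omega)
    (hdiss : piecewise_C1_dissection Omega
               Gamma Pi (boundary Omega `\` closure Gamma)) :
  exists Omegae : set 'rV[R]_3,
    [/\ lipschitz_domain Omegae,
        Omega `&` Omegae = set0,
        boundary Omega `&` boundary Omegae = Gamma `|` Pi &
        lipschitz_domain (Omega `|` Gamma `|` Omegae)].
Proof.
have [_ _ oO cO _] := hOmega.
have cones := lipschitz_domain_cone hOmega.
set Gamma2 := boundary Omega `\` closure Gamma in hdiss.
have [[bOmega GP0 GG0 PG0] [nG nG2] [oG oG2] [bG bG2] local] := hdiss.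
have GB : Gamma `<=` boundary Omega by rewrite bOmega => x Gx; left; left.
have PB : Pi `<=` boundary Omega by rewrite bOmega => x Px; left; right.
(* The relative boundary is passed to the ambient topology: a neighborhood of a point of
   [boundary Omega] is also one in the subspace. *)
have PG : Pi `<=` closure Gamma.
  move=> x Px; have bx := PB _ Px.
  move: Px; rewrite -bG => -[cx _] B nB; apply: cx.
  have := nbhs_subspace_in bx; rewrite /nbhs /= => <-.
  by apply: filterS nB => y.
have rel (A : set 'rV[R]_3) q : open (A : set (subspace (boundary Omega))) ->
    A q -> boundary Omega q ->
    exists2 d : R, 0 < d & forall x, boundary Omega x -> `|x - q| < d -> A x.
  move=> /open_subspaceP[V oV VA] Aq bq.
  have Vq : V q.
    have : (A `&` boundary Omega) q by [].
    by rewrite -VA => -[].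
  have [d d0 dP] := (open_normP V).1 oV q Vq.
  exists d => // x bx xq.
  have : (V `&` boundary Omega) x by split => //; exact: dP.
  by rewrite VA => -[].
have disj x : [/\ ~ (Gamma x /\ Pi x), ~ (Gamma x /\ Gamma2 x) & ~ (Pi x /\ Gamma2 x)].
  split=> H.
  - by have : (Gamma `&` Pi) x by []; rewrite GP0.
  - by have : (Gamma `&` Gamma2) x by []; rewrite GG0.
  - by have : (Pi `&` Gamma2) x by []; rewrite PG0.
have loc q : Pi q -> (exists e g, wall_chart Omega Gamma Pi Gamma2 q e g) /\
    tangent_frame_at Omega Gamma Pi q.
  by move=> Pq; have [Q [r [h [zeta [rho [H1 H2 H3 H4]]]]]] := local q Pq;
    exact: (dissection_chart oO GB PB Pq H1 H2 H3 H4).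
have lip (c : R) : lipschitz_fun (fun _ : 'rV[R]_3 => c).
  by exists 1 => // x y; rewrite subrr normr0 mul1r.
have charts q : boundary Omega q ->
    exists e g, wall_chart Omega Gamma Pi Gamma2 q e g.
  move=> bq; move: (bq); rewrite bOmega => -[[Gq|/loc[]//]|G2q].
    (* Around a point of [Gamma] or of [Gamma2] a constant function serves: a small ball misses
       [Pi], so the clauses on tangents are void. *)
    have [d d0 dP] := rel _ _ oG Gq bq.
    exists d, (fun=> -1); split => //.
    - move=> x bx xq; have Gx := dP x bx xq; have [n1 n2 _] := disj x.
      by split=> // H; [case: n1|case: n2].
    - by move=> x Px xq; have [n1 _ _] := disj x; case: n1; split => //; apply: dP => //; exact: PB.
    - by move=> Pq; have [n1 _ _] := disj q; case: n1.
  have [d d0 dP] := rel _ _ oG2 G2q bq.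
  exists d, (fun=> 1); split => //.
  - move=> x bx xq; have Gx := dP x bx xq; have [_ n2 n3] := disj x.
    by split=> // H; [case: n2|case: n3].
  - by move=> x Px xq; have [_ _ n3] := disj x; case: n3; split => //; apply: dP => //; exact: PB.
  - by move=> Pq; have [_ _ n3] := disj q; case: n3.
have [W [oW GW PW G2W Wcones]] :=
  wall_exists oO cO bOmega cones charts (fun q Pq => (loc q Pq).2).
exact: (wall_extension hOmega oW bOmega GW PW G2W PG nG nG2 Wcones).
Qed.
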